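(* Let $\Gamma = H \wr_X G$ be a finitely presented wreath product, where $H \neq 1$ and $X \neq \emptyset$, and let $\chi: \Gamma \to \mathbb{R}$ be a non-trivial character. If the set $$T = \{x \in X \mid \chi|_{H_x} \neq 0\}$$ has at least $3$ elements, then $[\chi] \in \Sigma^2(\Gamma)$.
   Context: Wreath product: given groups $H$, $G$ and a (left) $G$-set $X$, $H \wr_X G$ is the semidirect product $M \rtimes G$, where $M = \bigoplus_{x \in X} H_x$ is the restricted direct product of copies $H_x$ of $H$ indexed by $X$, and $G$ acts by permuting the copies according to its action on $X$. The groups $M$, $H_x$, $G$ are regarded as subgroups of $H \wr_X G$. Characters: for a finitely generated group $V$, a character is a homomorphism $\chi: V \to \mathbb{R}$ to the additive group of reals. The character sphere $S(V)$ is the set of non-zero characters modulo $\chi_1 \sim \chi_2$ iff $\chi_2 = r\chi_1$ for some real $r>0$; $[\chi]$ is the class of $\chi$. Put $V_\chi = \{v \in V \mid \chi(v) \geq 0\}$. Invariant $\Sigma^2$: let $V$ be finitely presented. For a finite presentation $\langle \mathcal{X} | \mathcal{R} \rangle$ of $V$, the Cayley complex $Cay(V; \langle \mathcal{X} | \mathcal{R} \rangle)$ is obtained from the Cayley graph (vertex set $V$, with $v_1,v_2$ joined by an edge iff $v_2 = v_1x$ for some $x\in\mathcal{X}^{\pm1}$) by gluing $2$-cells along the loops determined by the relators $r \in \mathcal{R}$ at each base point in $V$. $Cay(V; \langle \mathcal{X} | \mathcal{R} \rangle)_\chi$ is the full subcomplex spanned by $V_\chi$. Then $\Sigma^2(V)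 \subseteq S(V)$ is the set of classes $[\chi]$ such that $Cay(V; \langle \mathcal{X} | \mathcal{R} \rangle)_\chi$ is $1$-connected (connected and simply connected) for some finite presentation $\langle \mathcal{X} | \mathcal{R} \rangle$ of $V$. *)

(* Defs.v *)
From HB Require Import structures.
From mathcomp Require Import all_boot all_order all_algebra finmap.
From mathcomp Require Import boolp classical_sets functions cardinality reals.

Set Implicit Arguments.
Unset Strict Implicit.
Unset Printing Implicit Defensive.

Import Order.TTheory GRing.Theory Num.Theory.

Local Open Scope classical_set_scope.
Local Open Scope group_scope.

#[local] Obligation Tactic := idtac.

Record gset (G : groupType) := GSet {
  gset_sort :> choiceType;
  gact : G -> gset_sort -> gset_sort;
  gact1 : forall x, gact 1 x = x;
  gactM : forall g h x, gact (g * h) x = gact g (gact h x)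
}.

(** The restricted direct product of copies of [H] indexed by [X]: finitely
    supported functions under pointwise multiplication. *)
Definition rprod (X : choiceType) (H : groupType) : Type :=
  {fsfun X -> H with (1 : H)}.

Section RestrictedProduct.
Variables (X : choiceType) (H : groupType).
Local Notation M := (rprod X H).

HB.instance Definition _ := Choice.on M.

Lemma rprodP (m n : M) : m =1 n -> m = n.
Proof. by move=> mn; apply/fsfunP. Qed.

Definition rprod_one : M := [fsfun with (1 : H)].

Definition rprod_mul (m n : M) : M :=
  [fsfun x in (finsupp m `|` finsupp n)%fset => m x * n x | 1].

Definition rprod_inv (m : M) : M := [fsfun x in finsupp m => (m x)^-1 | 1].

Lemma rprod_oneE x : rprod_one x = 1.
Proof. by rewrite fsfun0E. Qed.

Lemma rprod_mulE m n x : rprod_mul m n x = m x * n x.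
Proof.
rewrite fsfun_fun in_fsetU.
case: (finsuppP m x) => //= _.
by case: (finsuppP n x) => _; rewrite ?mul1g.
Qed.

Lemma rprod_invE m x : rprod_inv m x = (m x)^-1.
Proof.
by rewrite fsfun_fun; case: (finsuppP m x) => _; rewrite ?invg1.
Qed.

Fact rprod_mulA : associative rprod_mul.
Proof. by move=> m n p; apply: rprodP => x; rewrite !rprod_mulE mulgA. Qed.

Fact rprod_mul1 : left_id rprod_one rprod_mul.
Proof.
by move=> m; apply: rprodP => x; rewrite rprod_mulE rprod_oneE mul1g.
Qed.

Fact rprod_mulr1 : right_id rprod_one rprod_mul.
Proof.
by move=> m; apply: rprodP => x; rewrite rprod_mulE rprod_oneE mulg1.
Qed.

Fact rprod_mulV : left_inverse rprod_one rprod_inv rprod_mul.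
Proof.
move=> m; apply: rprodP => x.
by rewrite rprod_mulE rprod_invE rprod_oneE mulVg.
Qed.

Fact rprod_mulrV : right_inverse rprod_one rprod_inv rprod_mul.
Proof.
move=> m; apply: rprodP => x.
by rewrite rprod_mulE rprod_invE rprod_oneE mulgV.
Qed.

HB.instance Definition _ := isGroup.Build M
  rprod_mulA rprod_mul1 rprod_mulr1 rprod_mulV rprod_mulrV.

End RestrictedProduct.

(** [g] carries the copy of [H] at [x] to the copy at [gact g x]; pointwise,
    [rprod_act g m x = m (gact g^-1 x)]. *)
Definition rprod_act (G H : groupType) (X : gset G) (g : G) (m : rprod X H) :
    rprod X H :=
  [fsfun x in (gact g @` finsupp m)%fset => m (gact g^-1 x) | 1].

(** The wreath product, i.e. the semidirect product of [rprod X H] by [G]; the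
    pair [(m, g)] stands for [m g], so [(m g) (n h) = (m (g . n)) (g h)]. *)
Record wreath (G H : groupType) (X : gset G) :=
  Wreath { wbase : rprod X H; wtop : G }.
Arguments wreath {G} H X.
Arguments Wreath {G H X}.

Section Wreath.
Variables (G H : groupType) (X : gset G).
Local Notation W := (wreath H X).

Lemma rprod_actE g (m : rprod X H) x : rprod_act g m x = m (gact g^-1 x).
Proof.
rewrite fsfun_fun; case: ifPn => // xN.
apply/esym/fsfun_dflt; apply: contra xN => xm; apply/imfsetP.
by exists (gact g^-1 x) => //=; rewrite -gactM mulgV gact1.
Qed.

Lemma rprod_act1 (m : rprod X H) : rprod_act 1 m = m.
Proof. by apply: rprodP => x; rewrite rprod_actE invg1 gact1. Qed.

Lemma rprod_actA g h (m : rprod X H) :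
  rprod_act (g * h) m = rprod_act g (rprod_act h m).
Proof. by apply: rprodP => x; rewrite !rprod_actE invgM gactM. Qed.

Lemma rprod_actM g (m n : rprod X H) :
  rprod_act g (m * n) = rprod_act g m * rprod_act g n.
Proof.
by apply: rprodP => x; rewrite !(rprod_actE, rprod_mulE).
Qed.

Lemma rprod_act_one g : rprod_act g (1 : rprod X H) = 1.
Proof. by apply: rprodP => x; rewrite !(rprod_actE, rprod_oneE). Qed.

Definition wreath_pair (w : W) := (wbase w, wtop w).
Definition pair_wreath (p : rprod X H * G) : W := Wreath p.1 p.2.

Fact wreath_pairK : cancel wreath_pair pair_wreath.
Proof. by case. Qed.

HB.instance Definition _ := Choice.copy W (can_type wreath_pairK).

Definition wreath_one : W := Wreath 1 1.

Definition wreath_mul (v w : W) : W :=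
  Wreath (wbase v * rprod_act (wtop v) (wbase w)) (wtop v * wtop w).

Definition wreath_inv (w : W) : W :=
  Wreath (rprod_act (wtop w)^-1 (wbase w)^-1) (wtop w)^-1.

Fact wreath_mulA : associative wreath_mul.
Proof.
by move=> [m g] [n h] [p k]; rewrite /wreath_mul /= rprod_actM rprod_actA !mulgA.
Qed.

Fact wreath_mul1 : left_id wreath_one wreath_mul.
Proof. by move=> [m g]; rewrite /wreath_mul /= rprod_act1 !mul1g. Qed.

Fact wreath_mulr1 : right_id wreath_one wreath_mul.
Proof. by move=> [m g]; rewrite /wreath_mul /= rprod_act_one !mulg1. Qed.

Fact wreath_mulV : left_inverse wreath_one wreath_inv wreath_mul.
Proof.
move=> [m g]; rewrite /wreath_mul /wreath_inv /= -rprod_actM !mulVg.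
by rewrite rprod_act_one.
Qed.

Fact wreath_mulrV : right_inverse wreath_one wreath_inv wreath_mul.
Proof.
move=> [m g]; rewrite /wreath_mul /wreath_inv /= -rprod_actA !mulgV.
by rewrite rprod_act1 mulgV.
Qed.

HB.instance Definition _ := isGroup.Build W
  wreath_mulA wreath_mul1 wreath_mulr1 wreath_mulV wreath_mulrV.

(** The subgroup [H_x]. *)
Definition copy_at (x : X) : set W :=
  [set w | wtop w = 1 /\ forall y, y <> x -> wbase w y = 1].

End Wreath.

(** Words in [S] and formal inverses: [(s, false)] is [s], [(s, true)] is
    [s^-1]. *)
Definition word (S : Type) := seq (S * bool).

Section Words.
Variables (S : Type) (V : groupType) (f : S -> V).

Definition letter_val (a : S * bool) : V := if a.2 then (f a.1)^-1 else f a.1.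
Definition word_val (w : word S) : V := \prod_(a <- w) letter_val a.

End Words.

(** Equality in the group [< S | rels >]: the congruence on words generated by
    free reduction and by the relators. *)
Inductive pres_eq (S : eqType) (rels : seq (word S)) :
    word S -> word S -> Prop :=
| PresRefl w : pres_eq rels w w
| PresSym v w : pres_eq rels v w -> pres_eq rels w v
| PresTrans u v w : pres_eq rels u v -> pres_eq rels v w -> pres_eq rels u w
| PresFree u w s b :
    pres_eq rels (u ++ (s, b) :: (s, ~~ b) :: w) (u ++ w)
| PresRel u w r : r \in rels -> pres_eq rels (u ++ r ++ w) (u ++ w).

(** A finite presentation of [V]: the evaluation of words induces an
    isomorphism from [< pgen | prel >] onto [V]. *)
Record presentation (V : groupType) := Presentation {
  pgen : finType;
  pval : pgen -> V;
  prel : seq (word pgen);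
  pval_surj : forall v, exists w, word_val pval w = v;
  prelP : forall w1 w2, word_val pval w1 = word_val pval w2 <->
                        pres_eq prel w1 w2
}.

Definition finitely_presented (V : groupType) : Prop :=
  inhabited (presentation V).

Section EdgePaths.
Variables (vert edge : Type) (src tgt : edge -> vert).

Fixpoint edge_path (u : vert) (p : seq edge) (v : vert) : Prop :=
  if p is e :: p' then src e = u /\ edge_path (tgt e) p' v else u = v.

End EdgePaths.

(** Combinatorial 2-complexes: [edge] consists of oriented edges, a geometric
    edge being a pair [{e, einv e}]; the 2-cell [f] is glued along the closed
    edge path [bdry f] based at [fbase f]. *)
Record complex2 := Complex2 {
  vert : Type;
  edge : eqType;
  face : Type;
  src : edge -> vert;
  tgt : edge -> vert;
  einv : edge -> edge;
  fbase : face -> vert;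
  bdry : face -> seq edge;
  einvK : involutive einv;
  einv_neq : forall e, einv e != e;
  src_einv : forall e, src (einv e) = tgt e;
  bdry_closed : forall f, edge_path src tgt (fbase f) (bdry f) (fbase f)
}.

Record subcomplex (K : complex2) := Subcomplex {
  svert : set (vert K);
  sedge : set (edge K);
  sface : set (face K);
  sedge_src : forall e, sedge e -> svert (src e);
  sedge_inv : forall e, sedge e -> sedge (einv e);
  sface_base : forall f, sface f -> svert (fbase f);
  sface_bdry : forall f, sface f -> forall e, e \in bdry f -> sedge e
}.

Lemma tgt_einv (K : complex2) (e : edge K) : tgt (einv e) = src e.
Proof. by rewrite -src_einv einvK. Qed.

Program Definition full_subcomplex (K : complex2) (A : set (vert K)) :
    subcomplex K :=
  @Subcomplex K A
    [set e | A (src e) /\ A (tgt e)]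
    [set f | A (fbase f) /\ forall e, e \in bdry f -> A (src e) /\ A (tgt e)]
    _ _ _ _.
Next Obligation. by move=> K A e []. Qed.
Next Obligation. by move=> K A e [Ae1 Ae2] /=; rewrite src_einv tgt_einv. Qed.
Next Obligation. by move=> K A f []. Qed.
Next Obligation. by move=> K A f [_ Af] e /Af. Qed.

Section OneConnected.
Variables (K : complex2) (S : subcomplex K).

Definition path_in (u : vert K) (p : seq (edge K)) (v : vert K) : Prop :=
  [/\ svert S u, edge_path (@src K) (@tgt K) u p v &
      forall e, e \in p -> sedge S e].

(** Homotopy, inside [S] and relative to endpoints, of edge paths from [u] to
    [v]; the fundamental group of [S] at [u] is the edge-path group
    [closed paths at u / homotopic u u]. *)
Inductive homotopic (u v : vert K) : seq (edge K) -> seq (edge K) -> Prop :=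
| HtRefl p : path_in u p v -> homotopic u v p p
| HtSym p q : homotopic u v p q -> homotopic u v q p
| HtTrans p q r : homotopic u v p q -> homotopic u v q r -> homotopic u v p r
| HtSpur p q e : sedge S e -> path_in u p (src e) -> path_in (src e) q v ->
    homotopic u v (p ++ e :: einv e :: q) (p ++ q)
| HtFace p q f : sface S f -> path_in u p (fbase f) ->
    path_in (fbase f) q v -> homotopic u v (p ++ bdry f ++ q) (p ++ q).

Definition connected2 : Prop :=
  svert S !=set0 /\
  forall u v, svert S u -> svert S v -> exists p, path_in u p v.

Definition simply_connected2 : Prop :=
  forall u p, path_in u p u -> homotopic u u p [::].

Definition one_connected : Prop := connected2 /\ simply_connected2.

End OneConnected.

Section CayleyComplex.
Variables (V : groupType) (P : presentation V).
Local Notation S := (pgen P).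
Local Notation val := (letter_val (@pval V P)).

(** The oriented edge [(v, a)] leads from [v] to [v * val a]. *)
Definition cay_edge : Type := (V * (S * bool))%type.
HB.instance Definition _ := Choice.on cay_edge.

Definition cay_src (e : cay_edge) : V := e.1.
Definition cay_tgt (e : cay_edge) : V := e.1 * val e.2.
Definition cay_inv (e : cay_edge) : cay_edge :=
  (cay_tgt e, (e.2.1, ~~ e.2.2)).

Fixpoint cay_trace (v : V) (w : word S) : seq cay_edge :=
  if w is a :: w' then (v, a) :: cay_trace (v * val a) w' else [::].

(** The 2-cell [(v, i)] is glued along the [i]-th relator read from [v]. *)
Definition cay_face : Type := (V * 'I_(size (prel P)))%type.
Definition cay_bdry (f : cay_face) : seq cay_edge :=
  cay_trace f.1 (nth [::] (prel P) f.2).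

Lemma letter_valN (a : S * bool) : val (a.1, ~~ a.2) = (val a)^-1.
Proof. by case: a => s [] /=; rewrite /letter_val /= ?invgK. Qed.

Lemma cay_trace_path v w :
  edge_path cay_src cay_tgt v (cay_trace v w) (v * word_val (@pval V P) w).
Proof.
elim: w v => [|a w IHw] v /=; first by rewrite /word_val big_nil mulg1.
by split=> //; rewrite /word_val big_cons mulgA; apply: IHw.
Qed.

Lemma relator_val r : r \in prel P -> word_val (@pval V P) r = 1.
Proof.
move=> rP; transitivity (word_val (@pval V P) [::]).
  by apply/prelP; have := PresRel [::] [::] rP; rewrite !cats0.
by rewrite /word_val big_nil.
Qed.

Program Definition cayley_complex : complex2 :=
  @Complex2 V cay_edge cay_face cay_src cay_tgt cay_inv fst cay_bdry _ _ _ _.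
Next Obligation.
move=> [v [s b]]; rewrite /cay_inv /cay_tgt /= (letter_valN (s, b)) mulgK.
by rewrite negbK.
Qed.
Next Obligation.
move=> [v [s b]]; apply/eqP => -[_]; by case: b.
Qed.
Next Obligation. by []. Qed.
Next Obligation.
move=> [v i]; have := cay_trace_path v (nth [::] (prel P) i).
by rewrite relator_val ?mulg1 // mem_nth.
Qed.

End CayleyComplex.

Section Characters.
Variables (R : realType) (V : groupType).

Record character := Character {
  char_fun :> V -> R;
  charM : forall v w, char_fun (v * w) = (char_fun v + char_fun w)%R
}.

Definition nontrivial (chi : character) : Prop := exists v, chi v <> 0%R.

Definition char_class (chi : character) : set character :=
  [set psi | exists2 r : R, (0 < r)%R & forall v, psi v = (r * chi v)%R].

Definition character_sphere : set (set character) :=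
  [set char_class chi | chi in nontrivial].

Definition Sigma2 : set (set character) :=
  [set char_class chi | chi in [set chi | nontrivial chi /\
    exists P : presentation V,
      one_connected (full_subcomplex (K := cayley_complex P)
                                     [set v : V | (0 <= chi v)%R])]].

Lemma Sigma2_sub_sphere : Sigma2 `<=` character_sphere.
Proof. by move=> _ [chi [chi_neq0 _] <-]; exists chi. Qed.

End Characters.

(* Main.v *)
Require Import Defs.
From mathcomp Require Import all_boot all_order all_algebra finmap.
From mathcomp Require Import boolp classical_sets functions cardinality reals.
From mathcomp Require Import ring lra.
Local Open Scope classical_set_scope.
Local Open Scope card_scope.

Set Implicit Arguments.
Unset Strict Implicit.
Unset Printing Implicit Defensive.

Import Order.TTheory GRing.Theory Num.Theory.

(** Let [T] be the set of points [x] such that [chi] is non-zero on [H_x]; the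
    group permutes it. Choose [tau x] in [H_x] for [x] in [T], of height at least
    one and depending on [x] only through its [G]-orbit ([step], [tau_ge1]). The
    elements [tau x] commute with one another, and [tau x] can be carried along
    an edge [z = m g] of the Cayley graph without a change as long as the
    coordinate [m x] is trivial ([tau_carry]). So each [x] in [T] is a direction
    in which the Cayley graph can be pushed up, except across the edges that
    have a non-trivial coordinate at [x].

    Pushing by the [k]-th power of [tau y0], for a fixed [y0], works globally: an
    edge that is trivial in some direction [y] is pushed along [y], and the
    pushes of its endpoints in the directions [y0] and [y] are joined by a path
    that runs higher up, because [tau y0] and [tau y] commute ([lift]). The
    result does not depend on [y], and it is multiplicative, up to homotopies
    that dip at most a constant, independent of [k], below the level [k] above the
    original path ([sim], [sim_lift_indep], [sim_lift_mul]). As an edge may be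
    non-trivial in all directions, it is first split into a single coordinate and
    the rest ([push]). The choice of the coordinate is irrelevant since two single
    coordinates commute, a relation that is trivial in a third direction; so three
    elements of [T] are needed ([push_via_indep]). Hence the push-up is multiplicative
    without exceptions ([push_mul]). In particular, the push-up of a relator of a
    given presentation is null-homotopic at a loss that is independent of [k];
    for [k] large enough, the relator has gained height.

    Such a push-up suffices ([htpy_lift]). The finitely many rectangles between
    the generators and their push-ups are added to the relators. A loop in the
    upper half space bounds a disc of some finite depth that is made of the old
    relators only; replacing the loop by its push-up, and the disc by the pushed
    disc, reduces the depth by one, and the collar between the loops consists of
    rectangles in the upper half space. Iteration brings the disc into the upper
    half space. *)

(** * Words, heights, and homotopy above level zero *)

Section InverseWords.
Variables (S : Type).

Definition inv_letter (a : S * bool) : S * bool := (a.1, ~~ a.2).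
Definition inv_word (w : word S) : word S := rev (map inv_letter w).

Lemma inv_letterK : involutive inv_letter.
Proof. by case=> s b; rewrite /inv_letter /= negbK. Qed.

Lemma inv_word_cons a w : inv_word (a :: w) = inv_word w ++ [:: inv_letter a].
Proof. by rewrite /inv_word /= rev_cons cats1. Qed.

Lemma inv_wordK : involutive inv_word.
Proof. by move=> w; rewrite /inv_word map_rev revK mapK //; apply: inv_letterK. Qed.

Definition pow (w : word S) (k : nat) : word S := iter k (cat w) [::].

End InverseWords.

Section Characters.
Variables (R : realType) (V : groupType) (chi : character R V).

Lemma char1 : chi 1%g = 0%R.
Proof.
have := charM chi 1%g 1%g; rewrite mulg1 => h.
by apply/eqP; rewrite -(inj_eq (addrI (chi 1%g))) -h addr0.
Qed.

Lemma charV v : chi v^-1%g = (- chi v)%R.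
Proof.
have := charM chi v v^-1%g; rewrite mulgV char1 => h.
by apply/eqP; rewrite -addr_eq0 addrC -h.
Qed.

Lemma charX v n : chi (v ^+ n)%g = (n%:R * chi v)%R.
Proof.
elim: n => [|n IHn]; first by rewrite expg0 char1 mul0r.
by rewrite expgS charM IHn -natr1; ring.
Qed.

End Characters.

Lemma nat_large (R : realType) (C : R) : exists n : nat, (C <= n%:R)%R.
Proof.
exists (Num.bound `|C|%R); apply: (le_trans (ler_norm C)).
exact/ltW/archi_boundP.
Qed.

Section Heights.
Local Open Scope group_scope.
Local Open Scope ring_scope.
Variables (R : realType) (V : groupType) (chi : character R V).
Variables (S : eqType) (f : S -> V).
Local Notation val := (word_val f).
Local Notation lval := (letter_val f).

Lemma word_val_nil : val [::] = 1%g.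
Proof. by rewrite /word_val big_nil. Qed.

Lemma word_val_cons a w : val (a :: w) = (lval a * val w)%g.
Proof. by rewrite /word_val big_cons. Qed.

Lemma word_val_cat u w : val (u ++ w) = (val u * val w)%g.
Proof. by rewrite /word_val big_cat. Qed.

Lemma letter_val_inv a : lval (inv_letter a) = (lval a)^-1%g.
Proof. by case: a => s []; rewrite /letter_val /= ?invgK. Qed.

Lemma word_val_inv w : val (inv_word w) = (val w)^-1%g.
Proof.
elim: w => [|a w IHw]; first by rewrite word_val_nil invg1.
rewrite inv_word_cons word_val_cat IHw !word_val_cons word_val_nil.
by rewrite letter_val_inv mulg1 invgM.
Qed.

Lemma word_val_pow w k : val (pow w k) = (val w ^+ k)%g.
Proof.
elim: k => [|k IHk]; first by rewrite word_val_nil expg0.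
by rewrite /= word_val_cat IHk expgS.
Qed.

Definition ht (w : word S) : R := chi (val w).

Lemma ht_nil : ht [::] = 0.
Proof. by rewrite /ht word_val_nil char1. Qed.

Lemma ht_cons a w : ht (a :: w) = chi (lval a) + ht w.
Proof. by rewrite /ht word_val_cons charM. Qed.

Lemma ht_cat u w : ht (u ++ w) = ht u + ht w.
Proof. by rewrite /ht word_val_cat charM. Qed.

Lemma ht_inv w : ht (inv_word w) = - ht w.
Proof. by rewrite /ht word_val_inv charV. Qed.

Lemma ht_pow w k : ht (pow w k) = k%:R * ht w.
Proof. by rewrite /ht word_val_pow charX. Qed.

(** The path labelled [w] that starts at a point of height [b] stays in the
    closed upper half space. Left translations of the Cayley graph shift all
    heights by a constant, so the height of the starting point is all that
    matters. *)
Fixpoint above (b : R) (w : word S) : bool :=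
  (0 <= b) && (if w is a :: w' then above (b + chi (lval a)) w' else true).

Lemma above_ge0 (b : R) w : above b w -> 0 <= b.
Proof. by case: w => [|a w] /= /andP[]. Qed.

Lemma above_cat (b : R) u w : above b (u ++ w) = above b u && above (b + ht u) w.
Proof.
elim: u b => [|a u IHu] b /=.
  rewrite ht_nil addr0 andbT; case: (boolP (above b w)) => [/above_ge0 ->//|_].
  by rewrite andbF.
by rewrite IHu ht_cons addrA andbA.
Qed.

Lemma above_end (b : R) w : above b w -> 0 <= b + ht w.
Proof. by rewrite -{1}[w]cats0 above_cat => /andP[_ /above_ge0]. Qed.

Lemma above_mono (b b' : R) w : b <= b' -> above b w -> above b' w.
Proof.
elim: w b b' => [|a w IHw] b b' le_bb' /=.
  by rewrite !andbT => b0; apply: le_trans b0 le_bb'.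
move=> /andP[b0 aw]; rewrite (le_trans b0 le_bb') /=.
by apply: IHw aw; rewrite lerD2r.
Qed.

Lemma above_inv (b : R) w : above b w -> above (b + ht w) (inv_word w).
Proof.
elim: w b => [|a w IHw] b; first by rewrite ht_nil addr0.
move=> /= /andP[b0 aw]; rewrite inv_word_cons above_cat ht_cons addrA IHw //=.
rewrite ht_inv letter_val_inv charV addrK (above_ge0 aw) /= andbT.
by rewrite addrK.
Qed.

Lemma above_large w : exists C, forall b, C <= b -> above b w.
Proof.
elim: w => [|a w [C HC]]; first by exists 0 => b /= ->.
exists (Num.max 0 (C - chi (lval a))) => b; rewrite ge_max => /andP[b0 bC] /=.
by rewrite b0 HC //; lra.
Qed.

(** The height does not decrease from one period to the next, so the first
    period is the lowest. *)
Lemma above_pow w : 0 <= ht w ->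
  exists C, forall b k, C <= b -> above b (pow w k).
Proof.
move=> w0; have [C HC] := above_large w.
exists (Num.max 0 C) => b k; elim: k b => [|k IHk] b; rewrite ge_max => /andP[b0 bC].
  by rewrite /= b0.
by rewrite /= above_cat HC //= IHk // ge_max; apply/andP; split; lra.
Qed.

(** Homotopy inside the upper half space of paths starting at height [b], the
    2-cells being the translates of [rels]. *)
Inductive htpy (rels : seq (word S)) (b : R) : word S -> word S -> Prop :=
| HtpyRefl w : above b w -> htpy rels b w w
| HtpySym u w : htpy rels b u w -> htpy rels b w u
| HtpyTrans u v w : htpy rels b u v -> htpy rels b v w -> htpy rels b u w
| HtpyFree u a w : above b (u ++ a :: inv_letter a :: w) ->
    htpy rels b (u ++ a :: inv_letter a :: w) (u ++ w)
| HtpyRel u r w : above b (u ++ r ++ w) -> r \in rels ->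
    htpy rels b (u ++ r ++ w) (u ++ w).

Lemma htpy_via rels (b : R) v u w : htpy rels b u v -> htpy rels b v w ->
  htpy rels b u w.
Proof. exact: HtpyTrans. Qed.

Section Homotopy.
Variable rels : seq (word S).
Hypothesis relsE : forall r, r \in rels -> val r = 1%g.

Lemma htpy_val (b : R) u w : htpy rels b u w -> val u = val w.
Proof.
elim=> {u w} [//|//|u v w _ -> //|u a w _|u r w _ rR].
  by rewrite !word_val_cat !word_val_cons letter_val_inv mulVKg.
by rewrite !word_val_cat (relsE rR) mul1g.
Qed.

Lemma htpy_ht (b : R) u w : htpy rels b u w -> ht u = ht w.
Proof. by move=> /htpy_val; rewrite /ht => ->. Qed.

Lemma htpy_above (b : R) u w : htpy rels b u w -> above b u /\ above b w.
Proof.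
elim=> {u w} [//|u w _ []//|u v w _ [? _] _ []//|u a w h|u r w h rR]; split=> //.
  move: h; rewrite !above_cat /= => /and4P[-> _ _]; rewrite letter_val_inv.
  by rewrite charV addrK.
move: h; rewrite !above_cat => /and3P[-> _] /=.
by rewrite [ht r]/ht relsE // char1 addr0.
Qed.

Lemma htpy_catl (b : R) u w w' : above b u -> htpy rels (b + ht u) w w' ->
  htpy rels b (u ++ w) (u ++ w').
Proof.
move=> au; elim=> {w w'} [w h|w w' _|u' v w _ h _|u' a w h|u' r w h rR].
- by apply: HtpyRefl; rewrite above_cat au.
- exact: HtpySym.
- exact: HtpyTrans.
- by rewrite !catA; apply: HtpyFree; rewrite -catA above_cat au.
- rewrite !catA -!(catA (u ++ u')); apply: HtpyRel => //.
  by rewrite -catA above_cat au.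
Qed.

Lemma htpy_catr (b : R) u u' w : htpy rels b u u' -> above (b + ht u) w ->
  htpy rels b (u ++ w) (u' ++ w).
Proof.
elim=> {u u'} [u h|u u' h IH|u v v' h IH _ IH'|u a v h|u r v h rR] aw.
- by apply: HtpyRefl; rewrite above_cat h.
- by apply/HtpySym/IH; rewrite (htpy_ht h).
- by apply: (HtpyTrans (IH aw)); apply: IH'; rewrite -(htpy_ht h).
- rewrite -!catA /=; apply: HtpyFree; move: aw h; rewrite -!cat_cons catA => aw h.
  by rewrite above_cat h.
- rewrite -!catA; apply: HtpyRel => //; move: aw h; rewrite !catA => aw h.
  by rewrite above_cat h.
Qed.

Lemma htpy_cat (b : R) u u' w w' : htpy rels b u u' -> htpy rels (b + ht u) w w' ->
  htpy rels b (u ++ w) (u' ++ w').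
Proof.
move=> hu hw; apply: (HtpyTrans (htpy_catr hu (proj1 (htpy_above hw)))).
by apply: htpy_catl (proj2 (htpy_above hu)) _; rewrite -(htpy_ht hu).
Qed.

Lemma htpy_cancel (b : R) w : above b w -> htpy rels b (w ++ inv_word w) [::].
Proof.
elim: w b => [|a w IHw] b; first exact: HtpyRefl.
move=> /= /andP[b0 aw]; rewrite inv_word_cons.
apply: (@HtpyTrans _ _ _ [:: a; inv_letter a]).
  rewrite catA; apply: (@htpy_catl b [:: a] _ [:: inv_letter a]).
    by rewrite /= b0 (above_ge0 aw).
  rewrite ht_cons ht_nil addr0; apply: (htpy_catr (IHw _ aw)) => /=.
  rewrite ht_cat ht_inv addrA addrK (above_ge0 aw) letter_val_inv charV addrK.
  by rewrite b0.
apply: (@HtpyFree _ _ [::] a [::]) => /=; rewrite b0 (above_ge0 aw) /= andbT.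
by rewrite letter_val_inv charV addrK.
Qed.

Lemma htpy_cancelV (b : R) w : above b (inv_word w) ->
  htpy rels b (inv_word w ++ w) [::].
Proof. by move=> /htpy_cancel; rewrite inv_wordK. Qed.

End Homotopy.

Lemma htpy_sub rels rels' b u w : {subset rels <= rels'} ->
  htpy rels b u w -> htpy rels' b u w.
Proof.
move=> sub; elim=> {u w} [w h|u w _|u v w _ h _|u a w h|u r w h /sub rR].
- exact: HtpyRefl.
- exact: HtpySym.
- exact: HtpyTrans.
- exact: HtpyFree.
- exact: HtpyRel.
Qed.

(** A derivation has finitely many steps, so all of it lies in the half space
    as soon as it starts high enough. *)
Lemma pres_eq_htpy rels u w : pres_eq rels u w ->
  exists C, forall b, C <= b -> htpy rels b u w.
Proof.
elim=> {u w} [w|u w _ [C HC]|u v w _ [C HC] _ [D HD]|u w s b|u w r rR].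
- have [C HC] := above_large w; exists C => b /HC; exact: HtpyRefl.
- by exists C => b /HC /HtpySym.
- exists (Num.max C D) => b; rewrite ge_max => /andP[/HC h /HD]; exact: HtpyTrans.
- have [C HC] := above_large (u ++ (s, b) :: (s, ~~ b) :: w); exists C => h /HC.
  by move=> /(@HtpyFree rels h u (s, b) w).
- have [C HC] := above_large (u ++ r ++ w); exists C => h /HC.
  by move=> /HtpyRel; apply.
Qed.

End Heights.

Arguments htpy_via {R V chi S f rels b} v {u w}.

(** * A push-up criterion *)

Section AddRelators.
Variables (V : groupType) (P : presentation V).
Variable Z : seq (word (pgen P)).
Hypothesis Z1 : forall z, z \in Z -> word_val (@pval V P) z = 1%g.

Lemma add_relatorsP w1 w2 : word_val (@pval V P) w1 = word_val (@pval V P) w2 <->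
  pres_eq (prel P ++ Z) w1 w2.
Proof.
split=> [/prelP|].
  elim=> {w1 w2} [w|u w _|u v w _ h _|u w s b|u w r rP] *.
  - exact: PresRefl.
  - exact: PresSym.
  - exact: PresTrans h _.
  - exact: PresFree.
  - by apply: PresRel; rewrite mem_cat rP.
elim=> {w1 w2} [//|//|u v w _ -> //|u w s b|u w r].
  rewrite !word_val_cat !word_val_cons (letter_val_inv _ (s, b)).
  by rewrite mulVKg.
rewrite mem_cat !word_val_cat => /orP[/relator_val|/Z1] ->; rewrite ?mul1g //.
Qed.

(** Consequences of the relators may be added freely; they matter because they
    add 2-cells to the half space. *)
Definition add_relators : presentation V :=
  @Presentation V (pgen P) (@pval V P) (prel P ++ Z) (@pval_surj V P)
    add_relatorsP.

End AddRelators.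

Section Substitution.
Variables (S : Type) (phi : S -> word S).

Definition subst_letter (a : S * bool) : word S :=
  if a.2 then inv_word (phi a.1) else phi a.1.

Definition subst (w : word S) : word S := flatten (map subst_letter w).

Lemma subst_cat u w : subst (u ++ w) = subst u ++ subst w.
Proof. by rewrite /subst map_cat flatten_cat. Qed.

Lemma subst_letter_inv a :
  subst_letter (inv_letter a) = inv_word (subst_letter a).
Proof. by case: a => s []; rewrite /subst_letter /= ?inv_wordK. Qed.

End Substitution.

Section Criterion.
Local Open Scope group_scope.
Local Open Scope ring_scope.
Variables (R : realType) (V : groupType) (chi : character R V).
Variable P : presentation V.
Local Notation S := (pgen P).
Local Notation f := (@pval V P).
Local Notation val := (word_val f).
Local Notation lval := (letter_val f).
Local Notation above := (above chi f).
Local Notation ht := (ht chi f).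
Local Notation htpy := (htpy chi f).

(* The word [T] leads from a vertex to its push-up, and [phi s] is the push-up of
   the edge [s]. As [h] may go down to [-1], the push-up of anything in the
   upper half space is filled at height at least one. *)
Variables (T : word S) (phi : S -> word S).
Hypothesis T_above : above 0 T.
Hypothesis T_high : 1 <= ht T.
Hypothesis phi_conj : forall s, (f s * val T = val T * val (phi s))%g.
Hypothesis phi_above : forall s (h : R), -1 <= h -> above (h + ht T) (phi s).
Hypothesis phi_rel : forall r, r \in prel P -> forall h : R, -1 <= h ->
  htpy (prel P) (h + ht T) (subst phi r) [::].

(** The relators closing the rectangles between an edge and its push-up. *)
Definition square (s : S) : word S :=
  (s, false) :: T ++ inv_word (phi s) ++ inv_word T.
Definition squares : seq (word S) := map square (enum S).

Lemma squares1 z : z \in squares -> val z = 1%g.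
Proof.
move=> /mapP[s _ ->]; rewrite /square word_val_cons !word_val_cat !word_val_inv.
rewrite mulgA /letter_val /= phi_conj.
by rewrite [X in X = _]mulgA mulgK mulgV.
Qed.

Local Notation rels := (prel P ++ squares).

Local Lemma rels1 r : r \in rels -> val r = 1%g.
Proof. by rewrite mem_cat => /orP[/relator_val|/squares1]. Qed.

Lemma subst_letter_conj a : (lval a * val T = val T * val (subst_letter phi a))%g.
Proof.
case: a => s [] /=; rewrite /letter_val /subst_letter /= ?phi_conj //.
rewrite word_val_inv; apply: (mulgI (f s)).
by rewrite mulVKg mulgA phi_conj mulgK.
Qed.

Lemma subst_conj w : (val w * val T = val T * val (subst phi w))%g.
Proof.
elim: w => [|a w IHw]; first by rewrite word_val_nil mulg1 mul1g.
rewrite /subst /= word_val_cat word_val_cons -mulgA IHw mulgA subst_letter_conj.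
by rewrite mulgA.
Qed.

Lemma ht_subst_letter a : ht (subst_letter phi a) = chi (lval a).
Proof.
have /(congr1 chi) := subst_letter_conj a; rewrite !charM -/(ht T) addrC.
by move=> /addrI.
Qed.

Lemma ht_subst w : ht (subst phi w) = ht w.
Proof.
have /(congr1 chi) := subst_conj w; rewrite !charM -/(ht T) addrC.
by move=> /addrI.
Qed.

Lemma subst_letter_above a (b : R) : -1 <= b -> -1 <= b + chi (lval a) ->
  above (b + ht T) (subst_letter phi a).
Proof.
have := ht_subst_letter a; case: a => s [] /=; rewrite /subst_letter /=; last first.
  by move=> _ b1 _; apply: phi_above.
move=> e b1 ba; have /above_inv := phi_above s ba.
suff -> : b + chi (lval (s, true)) + ht T + ht (phi s) = b + ht T by [].
by rewrite -e ht_inv; ring.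
Qed.

Lemma subst_above (b : R) w : above b w -> above (b - 1 + ht T) (subst phi w).
Proof.
elim: w b => [|a w IHw] b /=; first by rewrite !andbT; have := T_high; lra.
move=> /andP[b0 aw]; rewrite /subst /= above_cat; apply/andP; split.
  by apply: subst_letter_above; have := above_ge0 aw; lra.
rewrite ht_subst_letter; suff <- : b + chi (lval a) - 1 + ht T =
  b - 1 + ht T + chi (lval a) by exact: IHw.
by ring.
Qed.

Lemma subst_above0 (b : R) w : above b w -> above (b + ht T) (subst phi w).
Proof. by move=> /subst_above; apply: above_mono; lra. Qed.

(** Cancellations are pushed to cancellations, and relators of [P] to loops that
    [phi_rel] fills. The added rectangles have no push-up, which is why the
    homotopies that are pushed must avoid them. *)
Lemma subst_htpy (b : R) u w : htpy (prel P) b u w ->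
  htpy (prel P) (b - 1 + ht T) (subst phi u) (subst phi w).
Proof.
elim=> {u w} [w h|u w _|u v w _ h _|u a w h|u r w h rR].
- exact/HtpyRefl/subst_above.
- exact: HtpySym.
- exact: HtpyTrans.
- have := subst_above h; rewrite !subst_cat /subst /= -!/(subst phi _) subst_letter_inv.
  rewrite !above_cat => /and4P[au aa aai aw]; apply: htpy_catl => //.
  rewrite catA -[X in htpy _ _ _ X]cat0s; apply: (htpy_catr (@relator_val _ P)).
    exact: (htpy_cancel (@relator_val _ P)).
  by rewrite ht_cat addrA.
- have := subst_above h; rewrite !subst_cat !above_cat => /and3P[au ar aw].
  apply: htpy_catl => //; rewrite -[X in htpy _ _ _ X]cat0s.
  apply: (htpy_catr (@relator_val _ P)) => //.
  have /above_ge0 : above (b + ht u) (r ++ w).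
    by move: h; rewrite above_cat => /andP[].
  move=> bu; have /(_ (b - 1 + ht u)) := phi_rel rR.
  suff -> : b - 1 + ht T + ht (subst phi u) = b - 1 + ht u + ht T by apply; lra.
  by rewrite ht_subst; ring.
Qed.

Lemma above_T (b : R) : 0 <= b -> above b T.
Proof. by move=> b0; apply: above_mono T_above. Qed.

Lemma above_Tinv (b : R) : 0 <= b -> above (b + ht T) (inv_word T).
Proof. by move=> b0; apply/above_inv/above_T. Qed.

(** Attaching the rectangle and cancelling two of its sides. *)
Lemma collar_generator s (b : R) : 0 <= b -> 0 <= b + chi (f s) ->
  htpy rels b ((s, false) :: T) (T ++ phi s).
Proof.
move=> b0 bs; have aphi : above (b + ht T) (phi s) by apply: phi_above; lra.
have hphi : ht (phi s) = chi (f s) := ht_subst_letter (s, false).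
have asT : above b ((s, false) :: T) by rewrite /= b0 above_T.
have aphiV : above (b + chi (f s) + ht T) (inv_word (phi s)).
  by have := above_inv aphi; rewrite hphi -!addrA [ht T + _]addrC.
have hsT : ht ((s, false) :: T) = chi (f s) + ht T by rewrite ht_cons.
have bE : b + (chi (f s) + ht T) + - chi (f s) = b + ht T by ring.
have bE' : b + chi (f s) + ht T + - chi (f s) = b + ht T by ring.
apply: HtpySym; apply: (htpy_via (square s ++ T ++ phi s)).
  apply: HtpySym; apply: (@HtpyRel _ _ _ _ _ rels b [::] (square s)); last first.
    by rewrite mem_cat map_f ?orbT // mem_enum.
  rewrite /square -cat_cons cat0s -!catA above_cat asT hsT addrA above_cat aphiV.
  rewrite ht_inv hphi bE' above_cat above_Tinv // ht_inv addrK.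
  by rewrite above_cat above_T.
rewrite /square -cat_cons -!catA -[X in htpy _ _ _ X]cats0.
apply: htpy_catl => //; rewrite hsT.
apply: (htpy_via (inv_word (phi s) ++ phi s)); last first.
  by apply: (htpy_cancelV rels1); rewrite addrA.
apply: htpy_catl; first by rewrite addrA.
rewrite catA -[X in htpy _ _ _ X]cat0s ht_inv hphi bE.
apply: (htpy_catr rels1); first by apply: (htpy_cancelV rels1); rewrite above_Tinv.
by rewrite ht_cat ht_inv addNr addr0.
Qed.

Lemma collar_letter a (b : R) : 0 <= b -> 0 <= b + chi (lval a) ->
  htpy rels b (a :: T) (T ++ subst_letter phi a).
Proof.
case: a => s [] /=; last exact: collar_generator.
rewrite /letter_val /= charV => b0 bs.
have sq : htpy rels (b - chi (f s)) ((s, false) :: T) (T ++ phi s).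
  by apply: collar_generator; rewrite ?subrK.
have [_] := htpy_above rels1 sq; rewrite above_cat => /andP[aT aphi].
have hphi : ht (phi s) = chi (f s) := ht_subst_letter (s, false).
have aphiV : above (b + ht T) (inv_word (phi s)).
  by have := above_inv aphi; rewrite hphi; congr (above _ _); ring.
have as1 : above b [:: (s, true)] by rewrite /= b0 /letter_val /= charV bs.
have hs1 : ht [:: (s, true)] = - chi (f s).
  by rewrite ht_cons ht_nil addr0 /letter_val /= charV.
rewrite /subst_letter /=.
apply: (htpy_via ((s, true) :: T ++ phi s ++ inv_word (phi s))).
  apply: (@htpy_catl _ _ _ _ _ _ b [:: (s, true)]) => //; rewrite hs1.
  rewrite -{1}[T]cats0; apply: htpy_catl => //.
  by apply/HtpySym/(htpy_cancel rels1).
apply: (htpy_via ((s, true) :: (s, false) :: T ++ inv_word (phi s))).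
  apply: (@htpy_catl _ _ _ _ _ _ b [:: (s, true)]) => //; rewrite hs1.
  rewrite catA -cat_cons; apply: (htpy_catr rels1); first exact: HtpySym.
  by rewrite ht_cat hphi; move: aphiV; congr (above _ _); ring.
apply: (@HtpyFree _ _ _ _ _ _ b [::] (s, true)) => /=.
by rewrite /letter_val /= charV subrK b0 bs /= above_cat aphiV andbT above_T.
Qed.

(** A row of rectangles, one for each letter of [w]. *)
Lemma collar (b : R) w : above b w -> htpy rels b (w ++ T) (T ++ subst phi w).
Proof.
elim: w b => [|a w IHw] b.
  by rewrite cats0 /= andbT => b0; apply/HtpyRefl/above_T.
move=> /= /andP[b0 aw]; have ba := above_ge0 aw.
apply: (htpy_via (a :: T ++ subst phi w)).
  apply: (@htpy_catl _ _ _ _ _ _ b [:: a]); first by rewrite /= b0 ba.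
  by rewrite ht_cons ht_nil addr0; apply: IHw.
rewrite /subst /= -/(subst phi w) catA -cat_cons; apply: (htpy_catr rels1).
  exact: collar_letter.
by rewrite ht_cons addrA; apply: subst_above0.
Qed.

Lemma collar_conj (b : R) w : above b w ->
  htpy rels b w (T ++ subst phi w ++ inv_word T).
Proof.
move=> aw; have b0 := above_ge0 aw; have be := above_end aw.
apply: (htpy_via (w ++ T ++ inv_word T)).
  rewrite -{1}[w]cats0; apply: htpy_catl => //.
  by apply/HtpySym/(htpy_cancel rels1)/above_T.
rewrite !catA; apply: (htpy_catr rels1); first exact: collar.
by rewrite ht_cat addrA; apply: above_Tinv.
Qed.

(** Pushing up repeatedly: each application of [subst_htpy] gains one unit of
    height, and the collars between consecutive push-ups of the two paths lie in
    the upper half space. *)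
Lemma htpy_lift n (b : R) u w : above b u -> above b w ->
  htpy (prel P) (b + n%:R) u w -> htpy rels b u w.
Proof.
elim: n b u w => [|n IHn] b u w au aw h.
  by rewrite addr0 in h; apply: htpy_sub h => r; rewrite mem_cat => ->.
have b0 := above_ge0 au; have uw : val u = val w := htpy_val (@relator_val _ P) h.
apply: (HtpyTrans (collar_conj au)); apply/HtpySym/(HtpyTrans (collar_conj aw))/HtpySym.
apply: htpy_catl; first exact: above_T.
apply: (htpy_catr rels1).
  apply: IHn; [exact: subst_above0..|].
  have := subst_htpy h; suff -> : b + n.+1%:R - 1 + ht T = b + ht T + n%:R by [].
  by rewrite -natr1; ring.
by rewrite ht_subst addrAC; apply/above_Tinv/(above_end au).
Qed.

Lemma upper_simply_connected (b : R) w : above b w -> val w = 1%g ->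
  htpy rels b w [::].
Proof.
move=> aw w1; have [|C HC] := @pres_eq_htpy _ _ chi _ f (prel P) w [::].
  by apply/prelP; rewrite w1 word_val_nil.
have [n Cn] := nat_large C.
apply: (@htpy_lift n) => //; first by rewrite /= (above_ge0 aw).
by apply: HC; apply: le_trans Cn _; rewrite lerDr (above_ge0 aw).
Qed.

(** The same iteration, applied to an arbitrary path between the two vertices. *)
Lemma upper_connected (b : R) v : 0 <= b -> 0 <= b + chi v ->
  exists2 w, val w = v & above b w.
Proof.
suff lift n w (b' : R) : 0 <= b' -> 0 <= b' + ht w -> above (b' + n%:R) w ->
    exists2 w', val w' = val w & above b' w'.
  move=> b0 bv; have [w wv] := pval_surj P v; have [C HC] := above_large chi f w.
  have [n Cn] := nat_large (C - b); rewrite -wv.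
  by apply: (lift n w b b0); [rewrite /ht wv|apply: HC; lra].
elim: n w b' => [|n IHn] w b' b0 bw aw; first by exists w => //; rewrite addr0 in aw.
have [|||w' e aw'] := IHn (subst phi w) (b' + ht T).
- by have := T_high; lra.
- by rewrite ht_subst; have := T_high; lra.
- have := subst_above aw; suff -> : b' + n.+1%:R - 1 + ht T = b' + ht T + n%:R by [].
  by rewrite -natr1; ring.
exists (T ++ w' ++ inv_word T).
  by rewrite !word_val_cat e word_val_inv mulgA -subst_conj mulgK.
have hw' : ht w' = ht w by rewrite [LHS](congr1 chi e) -[RHS]ht_subst.
have aT := above_Tinv bw; rewrite addrAC in aT.
by rewrite 2!above_cat (above_T b0) aw' hw'.
Qed.

End Criterion.

(** * From words to the Cayley complex *)

Section UpperCayleyComplex.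
Local Open Scope group_scope.
Local Open Scope ring_scope.
Variables (R : realType) (V : groupType) (chi : character R V).
Variable P : presentation V.
Local Notation f := (@pval V P).
Local Notation val := (word_val f).
Local Notation K := (cayley_complex P).
Local Notation upper := (full_subcomplex (K := K) [set v : V | 0 <= chi v]).
Local Notation trace := (@cay_trace V P).

Lemma cay_trace_cat v u w :
  trace v (u ++ w) = trace v u ++ trace (v * val u)%g w.
Proof.
elim: u v => [|a u IHu] v /=; first by rewrite word_val_nil mulg1.
by rewrite IHu word_val_cons mulgA.
Qed.

Lemma above_chi_cat u w w' : above chi f (chi u) (w ++ w') =
  above chi f (chi u) w && above chi f (chi (u * val w)%g) w'.
Proof. by rewrite above_cat /ht -charM. Qed.

Lemma trace_in_upper u w : above chi f (chi u) w ->
  @path_in K upper u (trace u w) (u * val w)%g.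
Proof.
move=> aw; split; [exact: above_ge0 aw|exact: cay_trace_path|].
elim: w u aw => [//|a w IHw] u /= /andP[u0]; rewrite -charM => aw e.
rewrite inE => /orP[/eqP->|]; last exact: IHw.
by split; last exact: above_ge0 aw.
Qed.

Lemma path_in_upper u p v : @path_in K upper u p v ->
  exists w, [/\ p = trace u w, above chi f (chi u) w & v = (u * val w)%g].
Proof.
move=> [u0 pth inp]; elim: p u u0 pth inp => [|[u' a] p IHp] u u0 /=.
  by move=> <- _; exists [::]; rewrite /= u0 word_val_nil mulg1.
move=> [<- pth] inp.
have [e_src e_tgt] : upper.(sedge) (u', a) by apply: inp; rewrite mem_head.
have [|w [-> aw ->]] := IHp (u' * letter_val f a)%g e_tgt pth.
  by move=> e ep; apply: inp; rewrite inE ep orbT.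
exists (a :: w); rewrite word_val_cons mulgA; split=> //=.
by rewrite -charM aw andbT; apply: e_src.
Qed.

(** A word and a starting point determine a path, and the elementary moves on
    words are the elementary homotopies. *)
Lemma htpy_homotopic u w w' v : htpy chi f (prel P) (chi u) w w' ->
  v = (u * val w)%g -> @homotopic K upper u v (trace u w) (trace u w').
Proof.
move=> h; elim: h v => {w w'}
  [w aw|w w' h IH|w1 w2 w3 h1 IH1 _ IH2|w1 a w2 aw|w1 r w2 aw rP] v ->.
- exact/HtRefl/trace_in_upper.
- by apply/HtSym/IH; rewrite (htpy_val (@relator_val _ P) h).
- apply: HtTrans (IH1 _ erefl) (IH2 _ _).
  by rewrite (htpy_val (@relator_val _ P) h1).
- move: aw; rewrite !cay_trace_cat above_chi_cat => /= /andP[a1 /and3P[b0 b1]].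
  rewrite -!charM word_val_cat !word_val_cons letter_val_inv mulVKg mulgA mulgK.
  move=> a2.
  pose e : edge K := ((u * val w1)%g, a).
  apply: (@HtSpur K upper u _ _ _ e); last exact: trace_in_upper.
    by split=> //=; rewrite /cay_tgt /= charM.
  exact: trace_in_upper.
- move: aw; rewrite !cay_trace_cat !above_chi_cat => /and3P[a1 ar].
  rewrite !word_val_cat (relator_val rP) mulg1 mul1g mulgA => a2.
  have ri : (index r (prel P) < size (prel P))%N by rewrite index_mem.
  pose c : face K := ((u * val w1)%g, Ordinal ri).
  have -> : trace (u * val w1)%g r = bdry c.
    by rewrite /= /cay_bdry /= nth_index.
  apply: (@HtFace K upper u _ _ _ c); [|exact: trace_in_upper..].
  split; first exact: above_ge0 ar.
  by have [_ _] := trace_in_upper ar; rewrite /= /cay_bdry /= nth_index.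
Qed.

Lemma upper_one_connected :
  (forall (b : R) w, above chi f b w -> val w = 1%g ->
    htpy chi f (prel P) b w [::]) ->
  (forall (b : R) v, 0 <= b -> 0 <= b + chi v ->
    exists2 w, val w = v & above chi f b w) ->
  one_connected upper.
Proof.
move=> sc cn; split; first split.
- by exists 1%g => /=; rewrite char1.
- move=> u v /= u0 v0; have [|w wv aw] := cn (chi u) (u^-1 * v)%g u0.
    by rewrite -charM mulVKg.
  by exists (trace u w); have := trace_in_upper aw; rewrite wv mulVKg.
- move=> u p /path_in_upper[w [-> aw uw]].
  apply: (@htpy_homotopic u w [::]) => //; apply: sc => //.
  by apply: (mulgI u); rewrite -uw mulg1.
Qed.

End UpperCayleyComplex.

(** * Families of words and their homotopy at bounded loss *)

Section Families.
Local Open Scope group_scope.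
Local Open Scope ring_scope.
Variables (R : realType) (V : groupType) (chi : character R V).
Variable P : presentation V.
Local Notation S := (pgen P).
Local Notation f := (@pval V P).
Local Notation val := (word_val f).
Local Notation above := (above chi f).
Local Notation ht := (ht chi f).
Local Notation htpy := (htpy chi f (prel P)).
Local Notation relE := (@relator_val _ P).

Definition family : Type := nat -> word S.
Definition fnil : family := fun=> [::].
Definition fcat (U W : family) : family := fun k => U k ++ W k.
Definition finv (U : family) : family := fun k => inv_word (U k).

Local Infix "⋅" := fcat (at level 40, left associativity).

Lemma fcatA U W Z : U ⋅ (W ⋅ Z) = U ⋅ W ⋅ Z.
Proof. by apply/funext => k; rewrite /fcat catA. Qed.

Lemma fcats0 U : U ⋅ fnil = U.
Proof. by apply/funext => k; rewrite /fcat cats0. Qed.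

Lemma fcat0s U : fnil ⋅ U = U.
Proof. by apply/funext. Qed.

(** A family of type [al], [be] lifts a path of the Cayley graph between points
    of heights [h] and [h + c] to the levels [h + k * al] and [h + c + k * be].
    Two of them are similar when they are homotopic, for all [k] at once, at the
    price of a loss of height [C] below [h + k] that does not depend on [k]. *)
Definition sim (al be : R) (U W : family) : Prop :=
  exists c C : R, (forall k : nat, ht (U k) = k%:R * (be - al) + c) /\
    forall (k : nat) (h : R), C <= h + k%:R -> htpy (h + k%:R * al) (U k) (W k).

Lemma sim_sym al be U W : sim al be U W -> sim al be W U.
Proof.
move=> [c [C [hU H]]]; exists c, C; split=> [k|k h /H/HtpySym//].
by rewrite -hU; apply/esym/(htpy_ht relE (H k (C - k%:R) _)); rewrite subrK.
Qed.

Lemma sim_trans al be U W Z : sim al be U W -> sim al be W Z -> sim al be U Z.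
Proof.
move=> [c [C [hU H]]] [_ [D [_ H']]]; exists c, (Num.max C D); split=> // k h.
by rewrite ge_max => /andP[/H HC /H']; apply: HtpyTrans.
Qed.

Lemma sim_via W al be U Z : sim al be U W -> sim al be W Z -> sim al be U Z.
Proof. exact: sim_trans. Qed.

Lemma sim_refl al be U W : sim al be U W -> sim al be U U.
Proof. by move=> UW; apply: sim_trans UW (sim_sym UW). Qed.

Lemma sim_cat be al ga U U' W W' : sim al be U U' -> sim be ga W W' ->
  sim al ga (U ⋅ W) (U' ⋅ W').
Proof.
move=> [c [C [hU H]]] [c' [C' [hU' H']]].
exists (c + c'), (Num.max C (C' - c)); split=> [k|k h].
  by rewrite /fcat ht_cat hU hU'; ring.
rewrite ge_max => /andP[hC hC']; apply: (htpy_cat relE); first exact: H.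
have : C' <= h + c + k%:R by lra.
by move=> /H'; congr (htpy _ _ _); rewrite hU; ring.
Qed.

Lemma sim_catl be al ga U W W' : sim al be U U -> sim be ga W W' ->
  sim al ga (U ⋅ W) (U ⋅ W').
Proof. exact: sim_cat. Qed.

Lemma sim_catr be al ga U U' W : sim al be U U' -> sim be ga W W ->
  sim al ga (U ⋅ W) (U' ⋅ W).
Proof. exact: sim_cat. Qed.

Lemma sim_inv al be U : sim al be U U -> sim be al (finv U) (finv U).
Proof.
move=> [c [C [hU H]]]; exists (- c), (C + c); split=> [k|k h hC].
  by rewrite /finv ht_inv hU; ring.
have hC' : C <= h - c + k%:R by lra.
have [/above_inv] := htpy_above relE (H _ _ hC'); rewrite hU => aU _.
by apply: HtpyRefl; move: aU; congr (above _ _); ring.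
Qed.

Lemma sim_cancel be al U : sim al be U U -> sim al al (U ⋅ finv U) fnil.
Proof.
move=> [c [C [hU H]]]; exists 0, C; split=> [k|k h /H hUU].
  by rewrite /fcat /finv ht_cat ht_inv; ring.
by apply: (htpy_cancel relE); have [] := htpy_above relE hUU.
Qed.

Lemma sim_cancelV be al U : sim al be U U -> sim be be (finv U ⋅ U) fnil.
Proof.
move=> /sim_inv /sim_cancel; congr (sim _ _ (_ ⋅ _) _).
by apply/funext => k; rewrite /finv inv_wordK.
Qed.

(** Cancelling a reversed side at each end turns the commutation of two climbs
    into the commutation of a climb with a descent. *)
Lemma sim_square al be ga de A B A' B' :
  sim al be A A -> sim be de B B -> sim al ga B' B' -> sim ga de A' A' ->
  sim al de (A ⋅ B) (B' ⋅ A') -> sim be ga (finv A ⋅ B') (B ⋅ finv A').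
Proof.
move=> hA hB hB' hA' sq.
apply: (@sim_trans _ _ _ (finv A ⋅ B' ⋅ (A' ⋅ finv A'))).
  rewrite -[X in sim _ _ X]fcats0; apply: (@sim_catl ga).
    exact: sim_cat (sim_inv hA) hB'.
  exact/sim_sym/(sim_cancel hA').
rewrite -fcatA [B' ⋅ _]fcatA.
apply: (@sim_trans _ _ _ (finv A ⋅ (A ⋅ B ⋅ finv A'))).
  apply: (sim_catl (sim_inv hA)); apply: (sim_catr (sim_sym sq)).
  exact: sim_inv.
rewrite !fcatA -fcatA -[X in sim _ _ _ X]fcat0s.
by apply: sim_catr (sim_cancelV hA) (sim_cat hB (sim_inv hA')).
Qed.

Lemma htpy_large u w : val u = val w ->
  exists C, forall b, C <= b -> htpy b u w.
Proof. by move=> /prelP /pres_eq_htpy; apply. Qed.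

Lemma le_level (al h : R) (k : nat) : 1 <= al -> h + k%:R <= h + k%:R * al.
Proof. by move=> al1; rewrite lerD2l ler_peMr. Qed.

(** A single derivation is involved, whatever [k] is, hence a fixed loss. *)
Lemma sim_const al u w : 1 <= al -> val u = val w ->
  sim al al (fun=> u) (fun=> w).
Proof.
move=> al1 uw; have [C HC] := htpy_large uw.
exists (ht u), C; split=> [k|k h hC]; first by ring.
by apply: HC; apply: le_trans hC (le_level _ _ al1).
Qed.

Lemma sim_pow al be w : 1 <= al -> 0 <= ht w -> be = al + ht w ->
  sim al be (pow w) (pow w).
Proof.
move=> al1 w0 ->; have [C HC] := above_pow w0.
exists 0, C; split=> [k|k h hC]; first by rewrite ht_pow; ring.
by apply/HtpyRefl/HC/(le_trans hC)/le_level.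
Qed.

(** Powers of [w] can be moved across [u] one factor at a time, and no such
    move takes place lower than the one before. *)
Lemma htpy_pow_conj u w w' : val (u ++ w) = val (w' ++ u) -> 0 <= ht w ->
  exists C, forall b k, C <= b -> htpy b (u ++ pow w k) (pow w' k ++ u).
Proof.
move=> uw w0; have [C HC] := htpy_large uw; have [D HD] := above_large chi f w'.
have [E HE] := above_pow w0; have [F HF] := above_large chi f u.
have hw : ht w = ht w'.
  have /(congr1 chi) := uw; rewrite !word_val_cat !charM => h.
  by apply: (@addrI _ (ht u)); rewrite [RHS]addrC.
have hE b k : E <= b + ht u + ht w -> above (b + ht (u ++ w)) (pow w k).
  by rewrite ht_cat addrA; apply: HE.
exists (Num.max C (Num.max D (Num.max (E - ht u) F))) => b k.
elim: k b => [|k IHk] b; rewrite !ge_max => /and4P[bC bD bE bF] /=.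
  by rewrite cats0; apply/HtpyRefl/HF.
apply: (htpy_via (w' ++ u ++ pow w k)).
  rewrite !catA; apply: (htpy_catr relE); first exact: HC.
  by apply: hE; lra.
rewrite -catA; apply: htpy_catl; first exact: HD.
by apply: IHk; rewrite !ge_max; apply/and4P; split; lra.
Qed.

Lemma sim_pow_conj al be u w w' : val (u ++ w) = val (w' ++ u) ->
  1 <= al -> 0 <= ht w -> be = al + ht w ->
  sim al be ((fun=> u) ⋅ pow w) (pow w' ⋅ (fun=> u)).
Proof.
move=> uw al1 w0 ->; have [C HC] := htpy_pow_conj uw w0.
exists (ht u), C; split=> [k|k h hC]; first by rewrite /fcat ht_cat ht_pow; ring.
by apply: HC; apply: le_trans hC (le_level _ _ al1).
Qed.

(** All the rectangles are translates of one of them, and none lies lower than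
    the first: the loss does not depend on the number of rectangles. *)
Lemma sim_pow_comm al be w w' : val (w ++ w') = val (w' ++ w) ->
  1 <= al -> 0 <= ht w -> 0 <= ht w' -> be = al + ht w + ht w' ->
  sim al be (pow w ⋅ pow w') (pow w' ⋅ pow w).
Proof.
move=> ww' al1 w0 w'0 ->; have [C HC] := htpy_pow_conj ww' w'0.
have [D HD] := above_pow w0; have [E HE] := above_pow w'0.
have [F HF] := above_large chi f w.
pose M := Num.max C (Num.max D (Num.max E F)).
have H b j k : M <= b -> htpy b (pow w j ++ pow w' k) (pow w' k ++ pow w j).
  elim: j b => [|j IHj] b; rewrite !ge_max => /and4P[bC bD bE bF] /=.
    by rewrite cats0; apply/HtpyRefl/HE.
  apply: (htpy_via (w ++ pow w' k ++ pow w j)).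
    rewrite -catA; apply: htpy_catl; first exact: HF.
    by apply: IHj; rewrite !ge_max; apply/and4P; split; lra.
  rewrite !catA; apply: (htpy_catr relE); first exact: HC.
  have k0 : 0 <= k%:R * ht w' by rewrite mulr_ge0.
  by apply: HD; rewrite ht_cat ht_pow; lra.
exists 0, M; split=> [k|k h hC]; first by rewrite /fcat ht_cat !ht_pow; ring.
by apply: H; apply: le_trans hC (le_level _ _ al1).
Qed.

End Families.

Arguments sim_via {R V chi P} W {al be U Z}.

(** * Pushing along commuting directions *)

Section Directions.
Local Open Scope group_scope.
Local Open Scope ring_scope.
Variables (R : realType) (V : groupType) (chi : character R V).
Variable P : presentation V.
Local Notation S := (pgen P).
Local Notation f := (@pval V P).
Local Notation val := (word_val f).
Local Notation ht := (ht chi f).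
Local Notation sim := (sim chi (P := P)).
Local Infix "⋅" := fcat (at level 40, left associativity).

Variables (D : Type) (tau : D -> V) (mv : D -> V -> D).
Hypothesis tau_ge1 : forall y, 1 <= chi (tau y).
Hypothesis tau_comm : forall y w, (tau y * tau w = tau w * tau y)%g.
Hypothesis mv1 : forall y, mv y 1%g = y.
Hypothesis mvM : forall y a b, mv y (a * b)%g = mv (mv y a) b.

(** The direction [y] at the source of the edge [z] is parallel to the
    direction [mv y z] at its target. *)
Definition parallel (y : D) (z : V) : Prop := (tau y * z = z * tau (mv y z))%g.

Definition spell (z : V) : word S := sval (cid (pval_surj P z)).

Lemma val_spell z : val (spell z) = z.
Proof. by rewrite /spell; case: cid. Qed.

Lemma ht_spell z : ht (spell z) = chi z.
Proof. by rewrite /ht val_spell. Qed.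

Local Notation lv y := (chi (tau y)).

(** The path from a vertex to its push-up of level [k] in the direction [y]. *)
Definition climb (y : D) : family P := pow (spell (tau y)).

(** The path from the push-up in direction [y] to the push-up in direction [w];
    it climbs before it descends, so as to stay high. *)
Definition switch (y w : D) : family P := climb w ⋅ finv (climb y).

Local Lemma spell_tau_ge0 y : 0 <= ht (spell (tau y)).
Proof. by rewrite ht_spell; apply: le_trans (tau_ge1 y). Qed.

Lemma sim_climb al be y : 1 <= al -> be = al + lv y ->
  sim al be (climb y) (climb y).
Proof.
by move=> al1 ->; apply: sim_pow => //; [apply: spell_tau_ge0|rewrite ht_spell].
Qed.

Lemma sim_climbV al be y : 1 <= al -> be = al + lv y ->
  sim be al (finv (climb y)) (finv (climb y)).
Proof. by move=> al1 /(sim_climb al1)/sim_inv. Qed.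

Lemma sim_climb_comm al be y w : 1 <= al -> be = al + lv y + lv w ->
  sim al be (climb y ⋅ climb w) (climb w ⋅ climb y).
Proof.
move=> al1 ->; apply: sim_pow_comm => //; rewrite ?spell_tau_ge0 ?ht_spell //.
by rewrite !word_val_cat !val_spell.
Qed.

Lemma sim_climb_descend al ga de y w : 1 <= al -> ga = al + lv w ->
  de = al + lv y ->
  sim de ga (finv (climb y) ⋅ climb w) (climb w ⋅ finv (climb y)).
Proof.
move=> al1 -> ->; apply: (@sim_square _ _ _ _ al _ _ (al + lv y + lv w)).
- exact: sim_climb.
- by apply: sim_climb => //; have := tau_ge1 y; lra.
- exact: sim_climb.
- by apply: sim_climb; [have := tau_ge1 w; lra|ring].
- exact: sim_climb_comm.
Qed.

Lemma sim_switch y w : sim (lv y) (lv w) (switch y w) (switch y w).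
Proof.
apply: (@sim_cat _ _ _ _ (lv y + lv w)); first exact: sim_climb.
by apply: sim_climbV => //; rewrite addrC.
Qed.

Lemma sim_switch_id y : sim (lv y) (lv y) (switch y y) (@fnil _ P).
Proof. exact: sim_cancel (sim_climb (tau_ge1 y) erefl). Qed.

(** The climbs in the directions [y], [w], [z] span a cube with commuting faces;
    the three switches run on its upper part. *)
Lemma sim_switch_cat y w z :
  sim (lv y) (lv z) (switch y w ⋅ switch w z) (switch y z).
Proof.
have [y1 w1 z1] : [/\ 1 <= lv y, 1 <= lv w & 1 <= lv z] by split.
rewrite /switch !fcatA.
apply: (sim_via (climb w ⋅ climb z ⋅ finv (climb y) ⋅ finv (climb w))).
  apply: (@sim_catr _ _ _ _ (lv w + lv z)); last by apply: sim_climbV; rewrite // addrC.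
  rewrite -!fcatA; apply: (@sim_catl _ _ _ _ (lv y + lv w)); first exact: sim_climb.
  by apply: (@sim_climb_descend (lv w)) => //; rewrite addrC.
apply: (sim_via (climb z ⋅ climb w ⋅ finv (climb y) ⋅ finv (climb w))).
  apply: (@sim_catr _ _ _ _ (lv w + lv z)); last by apply: sim_climbV; rewrite // addrC.
  apply: (@sim_catr _ _ _ _ (lv y + lv w + lv z)).
    exact: sim_climb_comm.
  by apply: sim_climbV; [lra|ring].
rewrite -!fcatA; apply: (@sim_catl _ _ _ _ (lv y + lv z)); first exact: sim_climb.
apply: (sim_via (finv (climb y) ⋅ climb w ⋅ finv (climb w))).
  rewrite fcatA; apply: (@sim_catr _ _ _ _ (lv w + lv z)).
    by apply/sim_sym/(@sim_climb_descend (lv z)) => //; rewrite addrC.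
  by apply: sim_climbV; rewrite // addrC.
rewrite -fcatA -[X in sim _ _ _ X]fcats0; apply: (@sim_catl _ _ _ _ (lv z)).
  by apply: sim_climbV; rewrite // addrC.
exact: sim_cancel (sim_climb z1 erefl).
Qed.

Definition edge_family (z : V) : family P := fun=> spell z.

Lemma sim_edge_family al z : 1 <= al ->
  sim al al (edge_family z) (edge_family z).
Proof. by move=> al1; apply: sim_const. Qed.

Lemma parallel_lv y z : parallel y z -> lv (mv y z) = lv y.
Proof.
move=> /(congr1 chi); rewrite !charM => h.
by apply: (@addrI _ (chi z)); rewrite -h addrC.
Qed.

(** Both directions are carried along the edge [z], hence both climbs commute
    with it. *)
Lemma sim_switch_edge y w z : parallel y z -> parallel w z ->
  sim (lv y) (lv w) (switch y w ⋅ edge_family z)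
    (edge_family z ⋅ switch (mv y z) (mv w z)).
Proof.
move=> py pw; have [ey ew] := (parallel_lv py, parallel_lv pw).
have [y1 w1] : 1 <= lv y /\ 1 <= lv w by [].
have conj v al : parallel v z -> 1 <= al ->
    sim al (al + lv v) (edge_family z ⋅ climb (mv v z)) (climb v ⋅ edge_family z).
  move=> pv al1; have ev := parallel_lv pv.
  apply: sim_pow_conj => //; last by rewrite ht_spell ev.
    by rewrite !word_val_cat !val_spell pv.
  exact: spell_tau_ge0.
rewrite /switch.
apply: (sim_via (climb w ⋅ (edge_family z ⋅ finv (climb (mv y z))))).
  rewrite -fcatA; apply: (@sim_catl _ _ _ _ (lv y + lv w)); first exact: sim_climb.
  apply: (@sim_square _ _ _ _ (lv w) _ _ (lv y + lv w)).
  - by apply: sim_climb; rewrite // addrC.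
  - by apply: sim_edge_family; lra.
  - exact: sim_edge_family.
  - by apply: sim_climb; rewrite // ey addrC.
  - by rewrite addrC; apply/sim_sym/conj.
rewrite !fcatA; apply: (@sim_catr _ _ _ _ (lv y + lv w)).
  by apply/sim_sym/conj.
by apply: sim_climbV; rewrite // ey addrC.
Qed.

Variable y0 : D.
Local Notation a0 := (lv y0).

(** The push-up of the edge [z]: between the endpoints lifted in the direction
    [y0], detour through the lifts in a direction [y] that is parallel along
    [z]. *)
Definition lift (z : V) (y : D) : family P :=
  switch y0 y ⋅ edge_family z ⋅ switch (mv y z) y0.

(** A switch from [y] to [w], inserted before the edge, slides across it. *)
Lemma sim_lift_indep z y w : parallel y z -> parallel w z ->
  sim a0 a0 (lift z y) (lift z w).
Proof.
move=> py pw; have [ey ew] := (parallel_lv py, parallel_lv pw).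
have ez v : sim (lv v) (lv v) (edge_family z) (edge_family z).
  by apply: sim_edge_family.
have s1 v v' := sim_switch v v'; rewrite /lift.
apply: sim_sym; apply: (@sim_trans _ _ _ _ _ _ _
    (switch y0 y ⋅ switch y w ⋅ edge_family z ⋅ switch (mv w z) y0)).
  apply: (@sim_catr _ _ _ _ (lv w)); last by rewrite -ew.
  by apply: sim_catr (ez _); apply/sim_sym/sim_switch_cat.
apply: (sim_via (switch y0 y ⋅
    (edge_family z ⋅ switch (mv y z) (mv w z)) ⋅ switch (mv w z) y0)).
  apply: (@sim_catr _ _ _ _ (lv w)); last by rewrite -ew.
  by rewrite -fcatA; apply: sim_catl (s1 _ _) (sim_switch_edge py pw).
rewrite -2!(fcatA (switch y0 y)) -(fcatA (edge_family z)).
apply: sim_catl (s1 _ _) _; apply: sim_catl (ez _) _.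
by rewrite -ey; apply: sim_switch_cat.
Qed.

(** The two switches in the middle, through [y0], cancel. *)
Lemma sim_lift_mul a b y : parallel y a -> parallel (mv y a) b ->
  sim a0 a0 (lift a y ⋅ lift b (mv y a)) (lift (a * b)%g y).
Proof.
move=> pa pb; have [ea eb] := (parallel_lv pa, parallel_lv pb).
have ez z v : sim (lv v) (lv v) (edge_family z) (edge_family z).
  by apply: sim_edge_family.
have s1 v v' := sim_switch v v'; rewrite /lift mvM; set y' := mv y a.
have ey' : lv y' = lv y by [].
set u := switch y0 y ⋅ edge_family a; set v := edge_family b ⋅ switch (mv y' b) y0.
have su : sim a0 (lv y') u u by rewrite ey'; apply: sim_cat (s1 _ _) (ez _ _).
have sv : sim (lv y') a0 v v.
  by apply: sim_cat (ez _ _) _; rewrite -eb.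
apply: (sim_via (u ⋅ v)).
  have -> : u ⋅ switch y' y0 ⋅ (switch y0 y' ⋅ edge_family b ⋅ switch (mv y' b) y0)
    = u ⋅ (switch y' y0 ⋅ switch y0 y') ⋅ v by rewrite /v !fcatA.
  apply: sim_catr sv; rewrite -[X in sim _ _ _ X]fcats0; apply: sim_catl su _.
  by apply: sim_trans (sim_switch_cat _ _ _) (sim_switch_id _).
rewrite /u /v fcatA -(fcatA (switch y0 y)).
apply: (@sim_catr _ _ _ _ (lv y)); last by rewrite -ea -eb.
apply: sim_catl (s1 _ _) _; apply: (@sim_const _ _ _ _ _ (spell a ++ spell b)) => //.
by rewrite word_val_cat !val_spell.
Qed.

Lemma sim_lift1 y : sim a0 a0 (lift 1%g y) (@fnil _ P).
Proof.
rewrite /lift mv1; apply: (sim_via (switch y0 y ⋅ switch y y0)).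
  apply: (sim_catr _ (sim_switch _ _)); rewrite -[X in sim _ _ _ X]fcats0.
  apply: sim_catl (sim_switch _ _) _; apply: sim_const => //.
  by rewrite val_spell word_val_nil.
exact: sim_trans (sim_switch_cat _ _ _) (sim_switch_id _).
Qed.

Lemma val_climb y k : val (climb y k) = (tau y ^+ k)%g.
Proof. by rewrite word_val_pow val_spell. Qed.

(** The climbs in the direction [y] cancel, as they are carried along [z] and
    commute with those in the direction [y0]. *)
Lemma val_lift z y k : parallel y z ->
  val (lift z y k) = (tau y0 ^- k * z * tau y0 ^+ k)%g.
Proof.
move=> py; rewrite /lift /switch /fcat /finv !word_val_cat !word_val_inv !val_climb.
rewrite val_spell !mulgA.
have tc a b : ((tau a ^+ k) * (tau b ^- k) = tau b ^- k * tau a ^+ k)%g.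
  by apply/commuteV/commuteX2; apply: tau_comm.
have -> : (tau y ^+ k * tau y0 ^- k * z = tau y0 ^- k * z * tau (mv y z) ^+ k)%g.
  rewrite tc -!mulgA; congr (_ * _)%g.
  elim: k {tc} => [|k IHk]; first by rewrite !expg0 mul1g mulg1.
  by rewrite expgSr -mulgA py mulgA IHk -mulgA -expgSr.
by rewrite -[LHS]mulgA tc mulgA mulgK.
Qed.

End Directions.

(** * Directions in a wreath product *)

Section WreathCoordinates.
Local Open Scope group_scope.
Variables (G H : groupType) (X : gset G).
Local Notation W := (wreath H X).
Implicit Types (a b z : W) (x y : X) (h : H).

(** For [v = m g] one has [v H_x v^-1 = H_(g x)], so right multiplication by [H_x]
    at the vertex [v] amounts to left multiplication by [H_(g x)]. At the vertex
    [v z], the index that plays this part is [carry x z]. *)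
Definition carry x z : X := gact (wtop z)^-1 x.

Lemma carry1 x : carry x 1 = x.
Proof. by rewrite /carry /= invg1 gact1. Qed.

Lemma carryM x a b : carry x (a * b) = carry (carry x a) b.
Proof. by rewrite /carry /= invgM gactM. Qed.

Lemma carry_inj z : injective (carry^~ z).
Proof.
by move=> x y /(congr1 (gact (wtop z))); rewrite /carry -!gactM mulgV !gact1.
Qed.

Lemma wreath_eq a b : wbase a =1 wbase b -> wtop a = wtop b -> a = b.
Proof. by case: a b => [m g] [n k] /= /rprodP -> ->. Qed.

Lemma wbaseM a b x : wbase (a * b) x = wbase a x * wbase b (carry x a).
Proof. exact: etrans (rprod_mulE _ _ _) (congr1 _ (rprod_actE _ _ _)). Qed.

Lemma wbase1 x : wbase (1 : W) x = 1.
Proof. exact: rprod_oneE. Qed.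

Lemma wtopM a b : wtop (a * b) = wtop a * wtop b.
Proof. by []. Qed.

Definition single x h : W := Wreath [fsfun y in [fset x]%fset => h | 1] 1.

Lemma singleE x h y : wbase (single x h) y = if y == x then h else 1.
Proof. by rewrite fsfun_fun inE. Qed.

Lemma carry_single x y h : carry y (single x h) = y.
Proof. by rewrite /carry /= invg1 gact1. Qed.

Lemma singleM x h k : single x (h * k) = single x h * single x k.
Proof.
apply: wreath_eq => [y|]; last by rewrite wtopM mulg1.
by rewrite wbaseM carry_single !singleE; case: eqP; rewrite ?mulg1.
Qed.

Lemma single1 x : single x 1 = 1.
Proof. by apply: wreath_eq => // y; rewrite singleE wbase1 if_same. Qed.

Lemma singleV x h : single x h^-1 = (single x h)^-1.
Proof. by apply: (mulgI (single x h)); rewrite -singleM !mulgV single1. Qed.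

Lemma singleX x h n : single x (h ^+ n) = single x h ^+ n.
Proof.
elim: n => [|n IHn]; first by rewrite !expg0 single1.
by rewrite !expgS singleM IHn.
Qed.

(** Conjugation moves the copies of [H] around and, in the coordinate where the
    base part of the conjugating element is trivial, does nothing else. *)
Lemma single_comm z x h : wbase z x = 1 ->
  single x h * z = z * single (carry x z) h.
Proof.
move=> zx; apply: wreath_eq => [y|]; last by rewrite !wtopM /= mul1g mulg1.
rewrite !wbaseM carry_single !singleE (inj_eq (@carry_inj z)).
by case: eqP => [->|_]; rewrite ?zx ?mul1g ?mulg1.
Qed.

Lemma copy_at_single x z : copy_at x z -> z = single x (wbase z x).
Proof.
move=> [z1 zN]; apply: wreath_eq => // y; rewrite singleE.
by case: eqP => [->//|/zN].
Qed.

Lemma single_copy_at x h : copy_at x (single x h).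
Proof. by split=> // y /eqP/negPf yx; rewrite singleE yx. Qed.

End WreathCoordinates.

Section WreathDirections.
Local Open Scope group_scope.
Local Open Scope ring_scope.
Variables (R : realType) (G H : groupType) (X : gset G).
Local Notation W := (wreath H X).
Variable chi : character R W.

(** The two elements are conjugate. *)
Lemma chi_single x (z : W) h : chi (single (carry x z) h) = chi (single x h).
Proof.
have e : wbase (Wreath 1%g (wtop z) : W) x = 1%g by rewrite rprod_oneE.
have /(congr1 chi) := single_comm h e; rewrite !charM addrC => /addrI.
by rewrite {1}/carry /=.
Qed.

Definition direction : Type :=
  {x : X | exists2 w : W, copy_at x w & chi w <> 0}.

Fact carry_direction (y : direction) (z : W) :
  exists2 w : W, copy_at (carry (sval y) z) w & chi w <> 0.
Proof.
case: y => x [w wx w0] /=.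
exists (single (carry x z) (wbase w x)); first exact: single_copy_at.
by rewrite chi_single -copy_at_single.
Qed.

Definition carry_dir (y : direction) (z : W) : direction :=
  exist _ (carry (sval y) z) (carry_direction y z).

Lemma direction_eq (y w : direction) : sval y = sval w -> y = w.
Proof. by case: y w => [x p] [x' q] /=; apply: eq_exist. Qed.

(** The choice depends only on the set of admissible elements, hence is
    constant on [G]-orbits. *)
Definition step (x : X) : H := xget 1%g [set h | 1 <= chi (single x h)].

Lemma step_carry x (z : W) : step (carry x z) = step x.
Proof.
rewrite /step; congr (xget _ _); apply/funext => h; apply/propext => /=.
by rewrite chi_single.
Qed.

Definition tau (y : direction) : W := single (sval y) (step (sval y)).

(** A power of an element of [H_x] on which [chi] does not vanish, or of its
    inverse. *)
Lemma tau_ge1 y : 1 <= chi (tau y).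
Proof.
case: y => x xD; rewrite /tau /=.
suff: exists h, 1 <= chi (single x h).
  by move=> /(xgetPex 1%g); apply.
have [w /copy_at_single -> w0] := xD.
wlog w0' : w {w0} / 0 < chi (single x (wbase w x)).
  move=> IH; have [] := ltgtP 0 (chi (single x (wbase w x))); last by move=> /esym.
    exact: IH.
  move=> wn; apply: (IH (single x (wbase w x)^-1%g)).
  by rewrite singleE eqxx singleV charV oppr_gt0.
have [n n1] := nat_large (chi (single x (wbase w x)))^-1.
exists (wbase w x ^+ n)%g; rewrite singleX charX.
by rewrite -ler_pdivrMr // div1r.
Qed.

Lemma tau_carry y z : wbase z (sval y) = 1%g -> parallel tau carry_dir y z.
Proof. by move=> zy; rewrite /parallel /tau /= step_carry single_comm. Qed.

Lemma tau_comm y w : (tau y * tau w = tau w * tau y)%g.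
Proof.
have [yw|yw] := eqVneq (sval y) (sval w).
  by rewrite (direction_eq yw).
rewrite {1}/tau single_comm ?carry_single //.
by rewrite singleE (negPf yw).
Qed.

Lemma carry_dir1 y : carry_dir y 1%g = y.
Proof. by apply: direction_eq; rewrite /= carry1. Qed.

Lemma carry_dirM y a b : carry_dir y (a * b)%g = carry_dir (carry_dir y a) b.
Proof. by apply: direction_eq; rewrite /= carryM. Qed.

End WreathDirections.

(** * Pushing along three directions *)

Section Push.
Local Open Scope group_scope.
Local Open Scope ring_scope.
Variables (R : realType) (G H : groupType) (X : gset G).
Local Notation W := (wreath H X).
Variables (chi : character R W) (P : presentation W).
Local Notation D := (direction chi).
Local Notation tau := (@tau R G H X chi).
Local Notation carry := (@carry_dir R G H X chi).
Local Infix "⋅" := fcat (at level 40, left associativity).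

Hypothesis third : forall y w : D, exists v : D, v <> y /\ v <> w.
Variables (y0 y1 : D).
Hypothesis y10 : y1 <> y0.

Local Notation "U ≃ W" :=
  (sim chi (P := P) (chi (tau y0)) (chi (tau y0)) U W) (at level 70).
Local Notation lift := (lift P tau carry y0).
Local Notation coord z y := (wbase z (sval y)).
Local Notation trivial_at y z := (coord z y = 1%g).

Definition coord_part (y : D) (z : W) : W := single (sval y) (coord z y).
Definition coord_rest (y : D) (z : W) : W := ((coord_part y z)^-1 * z)%g.

Lemma coord_partK y z : (coord_part y z * coord_rest y z = z)%g.
Proof. exact: mulVKg. Qed.

Lemma coord_rest_trivial y z : trivial_at y (coord_rest y z).
Proof.
by rewrite /coord_rest /coord_part -singleV wbaseM carry_single singleE eqxx mulVg.
Qed.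

Lemma sval_neq (y w : D) : y <> w -> sval y == sval w = false.
Proof. by move=> yw; apply/eqP => /direction_eq. Qed.

Lemma single_trivial (y w : D) (h : H) : w <> y -> trivial_at w (single (sval y) h).
Proof. by move=> /sval_neq wy; rewrite singleE wy. Qed.

Lemma carry_single_dir (y : D) (x : X) (h : H) : carry y (single x h) = y.
Proof. by apply: direction_eq; rewrite /= carry_single. Qed.

Lemma single_swap (y w : D) (h k : H) : y <> w ->
  (single (sval y) h * single (sval w) k = single (sval w) k * single (sval y) h)%g.
Proof.
by move=> yw; rewrite single_comm ?carry_single //; apply: single_trivial.
Qed.

Lemma lift_indep z y w : trivial_at y z -> trivial_at w z -> lift z y ≃ lift z w.
Proof.
move=> /tau_carry py /tau_carry pw; apply: sim_lift_indep py pw.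
  exact: tau_ge1.
exact: tau_comm.
Qed.

Lemma lift_refl y z : trivial_at y z -> lift z y ≃ lift z y.
Proof. by move=> yz; apply: lift_indep. Qed.

Lemma lift_mul a b c y y' : trivial_at y a -> carry y a = y' ->
  trivial_at y' b -> (a * b)%g = c -> lift a y ⋅ lift b y' ≃ lift c y.
Proof.
move=> /tau_carry pa <- /tau_carry pb <-; apply: sim_lift_mul pa pb.
- exact: tau_ge1.
- exact: tau_comm.
- exact: carry_dirM.
Qed.

Definition push_via (y w : D) (z : W) : family P :=
  lift (coord_part y z) w ⋅ lift (coord_rest y z) y.

(** An element of the wreath product may be non-trivial in all directions, but
    splitting off one coordinate leaves two factors that are not. *)
Definition push (z : W) : family P := push_via y0 y1 z.

Lemma wf_push_via y w z : w <> y -> push_via y w z ≃ push_via y w z.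
Proof.
move=> wy; apply: sim_cat; apply: lift_refl; first exact: single_trivial.
exact: coord_rest_trivial.
Qed.

Lemma wf_push z : push z ≃ push z.
Proof. exact: wf_push_via. Qed.

(** Splitting off the coordinate [y], then the coordinate [y'], or the other way
    round: the two single coordinates commute thanks to a third direction, which
    is parallel along both of them. *)
Lemma push_via_indep y w y' w' z : w <> y -> w' <> y' ->
  push_via y w z ≃ push_via y' w' z.
Proof.
move=> wy wy'; have wf_rest v := lift_refl (coord_rest_trivial v z).
have [e|yy'] := pselect (y = y').
  rewrite -e in wy' *.
  by apply: sim_catr (wf_rest _); apply: lift_indep; apply: single_trivial.
have [v [vy vy']] := third y y'.
have y'y : y' <> y by congruence.
set s := coord_part y z; set s' := coord_part y' z.
pose r := (s'^-1 * coord_rest y z)%g.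
have sE : (s * s' = s' * s)%g by apply: single_swap.
have ry : trivial_at y r.
  rewrite /r /s' /coord_part -singleV wbaseM carry_single coord_rest_trivial mulg1.
  exact: single_trivial.
have rE : r = (s^-1 * coord_rest y' z)%g.
  by rewrite /r /coord_rest -/s -/s' !mulgA -!invgM sE.
have ry' : trivial_at y' r.
  rewrite rE /s /coord_part -singleV wbaseM carry_single coord_rest_trivial mulg1.
  exact: single_trivial.
have ws u : u <> y -> lift s u ≃ lift s u.
  by move=> uy; apply/lift_refl/single_trivial.
have ws' u : u <> y' -> lift s' u ≃ lift s' u.
  by move=> uy; apply/lift_refl/single_trivial.
apply: (sim_via (lift s v ⋅ (lift s' v ⋅ lift r y))).
  apply: sim_cat; first by apply: lift_indep; apply: single_trivial.
  apply: sim_sym; apply: (sim_via (lift s' y ⋅ lift r y)).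
    by apply: sim_catr (lift_refl ry); apply: lift_indep; apply: single_trivial.
  apply: lift_mul => //; [exact: single_trivial|exact: carry_single_dir|].
  exact: mulVKg.
apply: (sim_via (lift s' v ⋅ (lift s v ⋅ lift r y))).
  rewrite (fcatA (lift s v)) (fcatA (lift s' v)); apply: sim_catr (lift_refl ry).
  apply: (sim_via (lift (s * s')%g v)).
    by apply: lift_mul => //;
      [exact: single_trivial|exact: carry_single_dir|exact: single_trivial].
  apply: sim_sym; rewrite sE.
  by apply: lift_mul => //;
      [exact: single_trivial|exact: carry_single_dir|exact: single_trivial].
apply: sim_cat; first by apply: lift_indep; apply: single_trivial.
apply: (sim_via (lift s y' ⋅ lift r y')).
  by apply: sim_cat; apply: lift_indep => //; apply: single_trivial.
apply: lift_mul => //; [exact: single_trivial|exact: carry_single_dir|].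
by rewrite rE mulVKg.
Qed.

(** Multiplication by an element that is trivial in two directions: one of them
    serves to commute it with the coordinate that is split off, which belongs to
    the other. *)
Lemma push_mul2 y w c z : y <> w -> trivial_at y c -> trivial_at w c ->
  push (c * z)%g ≃ lift c y ⋅ push z.
Proof.
move=> yw cy cw; pose y' := carry y c; pose w' := carry w c.
have wy : w <> y by congruence.
have wy' : w' <> y' by move=> /(congr1 sval) /carry_inj /direction_eq.
apply: (sim_via (push_via y w (c * z)%g)).
  exact: push_via_indep.
apply: sim_sym; apply: (sim_via (lift c w ⋅ push_via y' w' z)).
  by apply: sim_cat; [apply: lift_indep|apply: push_via_indep].
have cz : coord (c * z)%g y = coord z y' by rewrite wbaseM cy mul1g.
have sc : (c * coord_part y' z = coord_part y (c * z) * c)%g.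
  by rewrite /coord_part cz single_comm.
rewrite /push_via (fcatA (lift c w)).
apply: (@sim_trans _ _ _ _ _ _ _
    (lift (coord_part y (c * z)%g) w ⋅ lift c w ⋅ lift (coord_rest y' z) y')).
  apply: sim_catr (lift_refl (coord_rest_trivial _ _)).
  apply: (sim_via (lift (c * coord_part y' z)%g w)).
    by apply: lift_mul => //; apply: single_trivial.
  apply: sim_sym; apply: lift_mul => //; first exact: single_trivial.
  exact: carry_single_dir.
rewrite -fcatA; apply: sim_catl; first exact/lift_refl/single_trivial.
apply: (sim_via (lift c y ⋅ lift (coord_rest y' z) y')).
  by apply: sim_catr (lift_refl (coord_rest_trivial _ _)); apply: lift_indep.
apply: lift_mul => //; first exact: coord_rest_trivial.
by apply: (mulgI (coord_part y (c * z)%g)); rewrite mulgA -sc -mulgA !coord_partK.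
Qed.

Lemma push1 : push 1%g ≃ @fnil _ P.
Proof.
have part1 : coord_part y0 1%g = 1%g by rewrite /coord_part wbase1 single1.
have rest1 : coord_rest y0 1%g = 1%g by rewrite /coord_rest part1 mulVg.
have lift1 y : lift 1%g y ≃ @fnil _ P.
  by apply: sim_lift1; [exact: tau_ge1|exact: tau_comm|exact: carry_dir1].
by rewrite /push /push_via part1 rest1 -[X in _ ≃ X]fcats0; apply: sim_cat.
Qed.

(** Every element is a product of three factors each of which is trivial in two
    directions: two single coordinates, and the rest. *)
Lemma push_mul a b : push (a * b)%g ≃ push a ⋅ push b.
Proof.
have y01 : y0 <> y1 by congruence.
have [v [v0 v1]] := third y0 y1.
have v0' : y0 <> v by congruence.
have v1' : y1 <> v by congruence.
set s := coord_part y0 a; set s' := coord_part y1 (coord_rest y0 a).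
set r := coord_rest y1 (coord_rest y0 a).
have r0 : trivial_at y0 r.
  rewrite /r {1}/coord_rest /coord_part -singleV wbaseM carry_single.
  by rewrite coord_rest_trivial mulg1; apply: single_trivial.
have r1 : trivial_at y1 r by apply: coord_rest_trivial.
have three z : push (a * z)%g ≃ lift s y1 ⋅ (lift s' y0 ⋅ (lift r y0 ⋅ push z)).
  rewrite -{1}(coord_partK y0 a) -{1}(coord_partK y1 (coord_rest y0 a)) -/s -/s' -/r.
  have s_y1 : trivial_at y1 s by apply: single_trivial.
  have s_v : trivial_at v s by apply: single_trivial.
  have s'_y0 : trivial_at y0 s' by apply: single_trivial.
  have s'_v : trivial_at v s' by apply: single_trivial.
  rewrite -(mulgA s) -(mulgA s'); apply: sim_trans (push_mul2 _ v1' s_y1 s_v) _.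
  apply: sim_catl (lift_refl s_y1) _; apply: sim_trans (push_mul2 _ v0' s'_y0 s'_v) _.
  by apply: sim_catl (lift_refl s'_y0) _; apply: push_mul2 y01 _ _.
apply: (sim_trans (three b)); apply: sim_sym.
have := three 1%g; rewrite mulg1 => three1.
have three0 : push a ≃ lift s y1 ⋅ (lift s' y0 ⋅ lift r y0).
  apply: (sim_trans three1); apply: sim_catl; first exact/lift_refl/single_trivial.
  apply: sim_catl; first exact/lift_refl/single_trivial.
  by rewrite -[X in _ ≃ X]fcats0; apply: sim_catl push1; apply: lift_refl.
apply: (sim_trans (sim_catr three0 (wf_push b))).
rewrite -(fcatA (lift s y1)) -(fcatA (lift s' y0)).
exact: sim_refl (sim_sym (three b)).
Qed.

Lemma val_push z k :
  word_val (@pval _ P) (push z k) = (tau y0 ^- k * z * tau y0 ^+ k)%g.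
Proof.
rewrite /push /push_via /fcat word_val_cat.
have vl a y : trivial_at y a ->
    word_val (@pval _ P) (lift a y k) = (tau y0 ^- k * a * tau y0 ^+ k)%g.
  by move=> /tau_carry; apply/val_lift/tau_comm.
rewrite vl ?vl; [|exact: coord_rest_trivial|exact: single_trivial].
by rewrite -{3}(coord_partK y0 z) !mulgA mulgK.
Qed.

End Push.

(** * The theorem *)

Section Assembly.
Local Open Scope group_scope.
Local Open Scope ring_scope.
Variables (R : realType) (G H : groupType) (X : gset G).
Local Notation W := (wreath H X).
Variables (chi : character R W) (P : presentation W).
Local Notation D := (direction chi).
Local Notation tau := (@tau R G H X chi).
Local Notation f := (@pval W P).
Local Notation val := (word_val f).
Local Notation ht := (ht chi f).
Local Notation above := (above chi f).
Local Infix "⋅" := fcat (at level 40, left associativity).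

Hypothesis third : forall y w : D, exists v : D, v <> y /\ v <> w.
Variables (y0 y1 : D).
Hypothesis y10 : y1 <> y0.

Local Notation a0 := (chi (tau y0)).
Local Notation "U ≃ U'" := (sim chi (P := P) a0 a0 U U') (at level 70).
Local Notation push := (push P y0 y1).

Definition push_gen (k : nat) (s : pgen P) : word (pgen P) := push (f s) k.

(** Inverses are unique in a groupoid, and [push] is multiplicative. *)
Lemma push_inv z : finv (push z) ≃ push z^-1%g.
Proof.
have wfp v := wf_push P y10 v.
have mulp u v := push_mul P third y10 u v.
apply: (sim_via (finv (push z) ⋅ (push z ⋅ push z^-1%g))).
  rewrite -[X in X ≃ _]fcats0; apply: sim_catl; first exact/sim_inv/wfp.
  apply: sim_sym; apply: (sim_trans (sim_sym (mulp _ _))).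
  by rewrite mulgV; apply: push1.
rewrite fcatA -[X in _ ≃ X]fcat0s; apply: sim_catr (wfp _).
exact: sim_cancelV (wfp z).
Qed.

Lemma subst_push w : (fun k => subst (push_gen k) w) ≃ push (val w).
Proof.
elim: w => [|a w IHw].
  by rewrite word_val_nil; apply/sim_sym/push1.
rewrite word_val_cons; apply: sim_sym; apply: sim_trans (push_mul P third y10 _ _) _.
apply: sim_sym.
apply: (@sim_cat _ _ _ _ a0 _ _ (fun k => subst_letter (push_gen k) a)) IHw.
case: a => s [] /=; last exact: wf_push.
exact: push_inv.
Qed.

Lemma push_conj k s : (f s * tau y0 ^+ k = tau y0 ^+ k * val (push_gen k s))%g.
Proof. by rewrite (val_push P y10) !mulgA mulgV mul1g. Qed.

Lemma seq_bound (A : eqType) (l : seq A) (Q : A -> R -> Prop) :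
  (forall x, x \in l -> exists C, Q x C) ->
  (forall x C C', C <= C' -> Q x C -> Q x C') ->
  exists C, forall x, x \in l -> Q x C.
Proof.
move=> ex up; elim: l ex => [|x l IHl] ex; first by exists 0.
have [|C HC] := IHl; first by move=> y yl; apply: ex; rewrite inE yl orbT.
have [C' HC'] := ex x (mem_head _ _).
exists (Num.max C C') => y; rewrite inE => /orP[/eqP->|/HC Qy].
  by apply: up HC'; rewrite le_max lexx orbT.
by apply: up Qy; rewrite le_max lexx.
Qed.

(** Repeating a single letter of positive height. *)
Lemma climbing_word (w : word (pgen P)) (C : R) : 0 < ht w ->
  exists w', above 0 w' /\ C <= ht w'.
Proof.
move=> w0; have [a a0] : exists a, 0 < chi (letter_val f a).
  apply: contrapT => /forallNP N; elim: w w0 => [|a w IHw].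
    by rewrite ht_nil ltxx.
  rewrite ht_cons => aw; apply: IHw.
  by have /negP := N a; rewrite -leNgt; lra.
have [n Cn] := nat_large (C / chi (letter_val f a)).
have hn m : ht (nseq m a) = m%:R * chi (letter_val f a).
  by elim: m => [|m IHm]; rewrite ?ht_nil ?mul0r //= ht_cons IHm -natr1; ring.
exists (nseq n a); split; last by rewrite hn -ler_pdivrMr.
elim: n {Cn} => [|n IHn] /=; first by rewrite lexx.
by rewrite lexx add0r; apply: above_mono IHn; apply: ltW.
Qed.

(** Finitely many generators and relators are concerned, so one constant bounds
    all the losses, for all [k]; then [k] is chosen larger than that constant. *)
Lemma upper_one_connected_wreath :
  exists P' : presentation W, one_connected (full_subcomplex
    (K := cayley_complex P') [set v : W | 0 <= chi v]).
Proof.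
have a1 : 1 <= a0 by apply: tau_ge1.
pose theta := spell P (tau y0).
have htheta : ht theta = a0 by apply: ht_spell.
have [Ct HCt] : exists C, forall b k, C <= b -> above b (pow theta k).
  by apply: above_pow; rewrite htheta; lra.
have [|w0 [aw0 w0C]] := @climbing_word theta Ct; first by rewrite htheta; lra.
have wfl (U U' : family P) : U ≃ U' ->
    exists C, forall (k : nat) h, C <= h + k%:R -> above (h + k%:R * a0) (U k).
  move=> [_ [C [_ HC]]]; exists C => k h /HC.
  by move=> /(htpy_above (@relator_val _ P))[].
have [C1 HC1] : exists C, forall s, s \in enum (pgen P) ->
    forall (k : nat) h, C <= h + k%:R -> above (h + k%:R * a0) (push_gen k s).
  apply: seq_bound => [s _|s C C' CC' HC k h C'h].
    exact: wfl (wf_push P y10 (f s)).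
  by apply: HC; apply: le_trans C'h.
have [C2 HC2] : exists C, forall r, r \in prel P -> forall (k : nat) h,
    C <= h + k%:R -> htpy chi f (prel P) (h + k%:R * a0) (subst (push_gen k) r) [::].
  apply: seq_bound => [r rP|r C C' CC' HC k h C'h]; last first.
    by apply: HC; apply: le_trans C'h.
  have : (fun k => subst (push_gen k) r) ≃ @fnil _ P.
    apply: sim_trans (subst_push r) _; rewrite (relator_val rP).
    exact: push1.
  by move=> [_ [C [_ HC]]]; exists C.
have [C3 HC3] := wfl _ _ (subst_push w0).
(* The summands [1] make room for starting heights as low as [-1]. *)
have [k] := nat_large (Num.max (C1 + 1) (Num.max (C2 + 1) (Num.max C3 1))).
rewrite !ge_max => /and4P[kC1 kC2 kC3 k1].
(* The element [tau y0 ^+ k] is spelt by a detour: first up to a safe height,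
   from there along powers of [theta], and back down along the push-up of the
   initial path, so that the path never descends below its starting point. *)
pose T := w0 ++ pow theta k ++ inv_word (subst (push_gen k) w0).
have tw0 : (val w0 * tau y0 ^+ k = tau y0 ^+ k * val (subst (push_gen k) w0))%g.
  elim: w0 {aw0 w0C HC3 T} => [|a w IHw]; first by rewrite word_val_nil mulg1 mul1g.
  rewrite /subst /= word_val_cat word_val_cons -mulgA IHw !mulgA; congr (_ * _)%g.
  case: a => s [] /=; rewrite /letter_val /subst_letter /= ?push_conj //.
  rewrite word_val_inv; apply: (mulgI (f s)).
  by rewrite mulVKg mulgA push_conj mulgK.
have valT : val T = (tau y0 ^+ k)%g.
  by rewrite /T !word_val_cat word_val_inv word_val_pow val_spell mulgA tw0 mulgK.
have htT : ht T = k%:R * a0 by rewrite -charX -valT.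
have T_above : above 0 T.
  rewrite /T above_cat aw0 above_cat add0r HCt //=.
  have /above_inv : above (0 + k%:R * a0) (subst (push_gen k) w0).
    by apply: HC3; rewrite add0r.
  have /(congr1 chi) := tw0; rewrite !charM charX => e.
  by rewrite ht_pow htheta add0r; congr (above _ _); rewrite -e addrC.
have T_high : 1 <= ht T.
  by rewrite htT; apply: (le_trans a1); rewrite ler_peMl //; lra.
have conjT s : (f s * val T = val T * val (push_gen k s))%g.
  by rewrite valT push_conj.
have aboveT s (h : R) : -1 <= h -> above (h + ht T) (push_gen k s).
  by move=> h1; rewrite htT; apply: HC1; [rewrite mem_enum|lra].
have relT r : r \in prel P -> forall h : R, -1 <= h ->
    htpy chi f (prel P) (h + ht T) (subst (push_gen k) r) [::].
  by move=> rP h h1; rewrite htT; apply: HC2 => //; lra.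
exists (add_relators (squares1 conjT)); apply: upper_one_connected => b.
  exact: (upper_simply_connected T_above T_high conjT aboveT relT).
exact: (upper_connected T_above T_high conjT aboveT).
Qed.

End Assembly.

Theorem theorem2 (R : realType) (G H : groupType) (X : gset G)
    (chi : character R (wreath H X)) :
  finitely_presented (wreath H X) ->
  (exists h : H, h <> 1%g) ->
  [set: X] !=set0 ->
  nontrivial chi ->
  [set: 'I_3] #<= [set x : X | exists2 w, copy_at x w & chi w <> 0%R] ->
  Sigma2 (char_class chi).
Proof.
move=> [P] _ _ chi0 /card_leP[d]; exists chi => //; split=> //.
pose point (i : 'I_3) : set_type [set: 'I_3] :=
  SigSub (mem_set (I : [set: 'I_3] i)).
pose dir (i : 'I_3) : direction chi :=
  exist _ (set_val (d (point i))) (set_valP (d (point i))).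
have dirE i j : i != j -> dir i <> dir j.
  move=> /eqP ij /(congr1 sval) /= /val_inj dij; apply: ij.
  have : point i = point j by apply: (@inj _ _ _ d); rewrite ?inE.
  by move=> /(congr1 set_val).
pose i1 : 'I_3 := Ordinal (isT : 1 < 3)%N; pose i2 : 'I_3 := Ordinal (isT : 2 < 3)%N.
have n01 := dirE ord0 i1 isT; have n02 := dirE ord0 i2 isT.
have n12 := dirE i1 i2 isT.
apply: (@upper_one_connected_wreath _ _ _ _ chi P _ (dir ord0) (dir i1));
  last by move=> /esym.
move=> y w.
have [e0|e0] := pselect (dir ord0 = y \/ dir ord0 = w); last first.
  by exists (dir ord0); split=> e; apply: e0; [left|right].
have [e1|e1] := pselect (dir i1 = y \/ dir i1 = w); last first.
  by exists (dir i1); split=> e; apply: e1; [left|right].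
exists (dir i2); case: e0 e1 => [e0|e0] [e1|e1]; split=> e2; congruence.
Qed.
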